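(* Let $k_0\ge3$ be an integer and $\lambda>0$. Consider the random walk on the growing complete graph with parameters $k_0$ and $\lambda$ (defined in the context), started at $v_1$. For an integer $T\ge1$ let $E_1^{k_0}[T]$ be the expected number of visits to $v_1$ up to time $T$ (not counting the initial presence at time $0$). Then $$E_1^{k_0}[T]=\sum_{i=0}^{T-1}\left(\frac{\lambda}{k_0+i}+\frac{1-Q(i,k_0)(k_0+i)}{(k_0+i)^2}\left(1-e^{-\lambda\frac{k_0+i}{k_0+i-1}}\right)\right),$$ where, for every integer $i\ge0$, $$Q(i,k_0)=\left(\prod_{l=1}^{i}e^{-\lambda\frac{k_0+l-1}{k_0+l-2}}\right)\left(1+\sum_{j=1}^{i}\frac{1-e^{-\lambda\frac{k_0+j-1}{k_0+j-2}}}{(k_0+j-1)\prod_{l=1}^{j}e^{-\lambda\frac{k_0+l-1}{k_0+l-2}}}\right).$$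
   Context: Model (random walk on the growing complete graph). At time $0$ there are $k_0\ge 3$ vertices $v_1,\dots,v_{k_0}$ forming a complete graph, and a walker sits at $v_1$. For each $t\in\{1,2,\dots\}$, a new vertex $v_{k_0+t}$ is created at time $t$ and joined to all present vertices; thus during the time interval $[t-1,t)$ the graph is the complete graph on $v_1,\dots,v_{k_0+t-1}$. The walker moves at random times: the times between successive moves (and up to the first move) are i.i.d. exponential with mean $1/\lambda$, so the move times form a Poisson process of rate $\lambda$; in particular the numbers $M_t$ of moves in $[t-1,t)$, $t\ge1$, are independent Poisson random variables with parameter $\lambda$. At each move the walker jumps to a vertex chosen uniformly at random among the vertices present at that time other than her current vertex, independently of the move times and of the past given her current position. A visit to $v_1$ is a move that ends at $v_1$. Empty products equal $1$ and empty sums equal $0$. ($Q(i,k_0)$ is the probability that the walker is at $v_1$ at time $i$.) *)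

(* Defs.v *)
From mathcomp Require Import all_boot all_order all_algebra.
From mathcomp Require Import all_classical all_reals all_analysis.

Set Implicit Arguments.
Unset Strict Implicit.
Unset Printing Implicit Defensive.

Import Order.TTheory GRing.Theory Num.Theory.

Local Open Scope classical_set_scope.
Local Open Scope ring_scope.

(* The vertex v_j is represented by the natural number j >= 1. *)

Definition mutually_independent d (Omega : measurableType d) (R : realType)
    (P : probability Omega R) (tau : nat -> {RV P >-> R}) : Prop :=
  forall (s : seq nat) (B : nat -> set R), uniq s ->
    (forall k, measurable (B k)) ->
    P (\bigcap_(k in [set` s]) (tau k @^-1` B k)) =
    (\prod_(k <- s) P (tau k @^-1` B k))%E.

(* During [t - 1, t) the vertices are v_1, ..., v_(k0 + t - 1). *)
Definition present (R : realType) (k0 : nat) (s : R) : seq nat :=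
  iota 1 (k0 + Num.truncn s).

Definition neighbours (R : realType) (k0 : nat) (s : R) (x : nat) : seq nat :=
  [seq y <- present k0 s | y != x].

Definition jump_prob (R : realType) (k0 : nat) (s : R) (x y : nat) : R :=
  if y \in neighbours k0 s x then (size (neighbours k0 s x))%:R^-1 else 0.

(* tau k is the time between the k-th and the (k+1)-st move, so move_time tau n
   is the time of the n-th move (moves are numbered from 1) and
   move_time tau 0 = 0. *)
Definition move_time d (Omega : measurableType d) (R : realType)
    (P : probability Omega R) (tau : nat -> {RV P >-> R}) (n : nat)
    (w : Omega) : R :=
  \sum_(0 <= k < n) tau k w.

(* Sigma-algebra generated by all the move times and the positions
   X 0, ..., X n. *)
Definition history d (Omega : measurableType d) (R : realType)
    (P : probability Omega R) (tau : nat -> {RV P >-> R})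
    (X : nat -> {RV P >-> nat}) (n : nat) : set_system Omega :=
  <<s [set A | (exists k (B : set R), measurable B /\ A = tau k @^-1` B) \/
               (exists m (B : set nat), [/\ (m <= n)%N, measurable B &
                                            A = X m @^-1` B])] >>.

(* X n is the position of the walker just after the n-th move.  The field
   walk_jump says that jump_prob k0 (move_time tau n.+1) (X n) y is a version of
   the conditional probability of {X n.+1 = y} given history tau X n. *)
Record growing_complete_walk d (Omega : measurableType d) (R : realType)
    (P : probability Omega R) (k0 : nat) (lambda : R)
    (tau : nat -> {RV P >-> R}) (X : nat -> {RV P >-> nat}) : Prop := {
  walk_exponential : forall k (B : set R), measurable B ->
    distribution P (tau k) B = exponential_prob lambda B ;
  walk_independent : mutually_independent tau ;
  walk_start : forall w, X 0%N w = 1%N ;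
  walk_jump : forall (n y : nat) (A : set Omega), history tau X n A ->
    P (A `&` X n.+1 @^-1` [set y]) =
    (\int[P]_(w in A) (jump_prob k0 (move_time tau n.+1 w) (X n w) y)%:E)%E }.

Definition at_time d (Omega : measurableType d) (R : realType)
    (P : probability Omega R) (tau : nat -> {RV P >-> R})
    (X : nat -> {RV P >-> nat}) (t : R) (v : nat) : set Omega :=
  [set w | exists n, move_time tau n w <= t < move_time tau n.+1 w /\
                     X n w = v].

Definition visits d (Omega : measurableType d) (R : realType)
    (P : probability Omega R) (tau : nat -> {RV P >-> R})
    (X : nat -> {RV P >-> nat}) (v : nat) (t : R) (w : Omega) : \bar R :=
  counting [set n : nat | [/\ (0 < n)%N, move_time tau n w <= t & X n w = v]].

Definition expected_visits d (Omega : measurableType d) (R : realType)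
    (P : probability Omega R) (tau : nat -> {RV P >-> R})
    (X : nat -> {RV P >-> nat}) (v : nat) (t : R) : \bar R :=
  (\int[P]_w visits tau X v t w)%E.

(* Main.v *)
(**
For an event D that depends on the first n moves, write p_D(t) for the
probability of D and S_n <= t < S_(n+1), where S_n is the time of the n-th move.
Since the waiting time after S_n is exponential and independent of D and S_n,
S_(n+1) has on D the density lambda p_D(t).  Apply this to D = {X_n <> v_1}, from
which the next move leads to v_1 with probability g(t) = 1 / (k0 + |_t_| - 1),
and sum over n: the visits have intensity lambda g(t) (1 - q(t)), where q(t) is
the probability of being at v_1 at time t, and
  q(t) = exp(- lambda t) + \int_0^t exp(- lambda (t - s)) lambda g(s) (1 - q(s)) ds.
On [i, i + 1[ the function g is constant, hence q solves a linear differential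
equation with constant coefficients there, and both claims follow by integration.
*)

From HB Require Import structures.
Require Import Defs.
From mathcomp Require Import all_boot all_order all_algebra.
From mathcomp Require Import all_classical all_reals all_analysis.
From mathcomp Require Import measurable_realfun.
From mathcomp Require Import ring lra.

Set Implicit Arguments.
Unset Strict Implicit.
Unset Printing Implicit Defensive.

Import Order.TTheory GRing.Theory Num.Theory.
Import numFieldNormedType.Exports.

Local Open Scope classical_set_scope.
Local Open Scope ring_scope.

(** * Transfer of weighted integrals *)

(** The delicate point is that the position after n moves and S_n are independent of the waiting
    time that follows. The model does not state this: the waiting times are independent of each
    other, and the jump law is conditioned on a history that contains all of them, future ones
    included. The independence is proved by induction on n, carrying events on later waiting times
    along in the conditioning event. The induction closes on the events of being and of not being at
    v_1, because the jump probability to v_1 is the same from all other present vertices and depends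
    only on S_(n+1). Two more points need an argument. The probabilities of being and of not being
    at v_1 at time t add up to 1 only if almost surely t falls between two successive moves; this
    follows from the same density formula. And q is at first only measurable: the integral equation,
    multiplied by exp(lambda t), makes q an indefinite integral up to a smooth factor and thus
    supplies the continuity that the differential equation requires. *)

Lemma measurable_preimageT d d' (Y : measurableType d) (Z : measurableType d')
    (s : Y -> Z) (A : set Z) :
  measurable_fun setT s -> measurable A -> measurable (s @^-1` A).
Proof. by move=> ms mA; rewrite -[X in measurable X]setTI; exact: ms. Qed.

Section integral_transfer.
Local Open Scope ereal_scope.
Import HBNNSimple.

(** Approximation of [phi] by simple functions: the right-hand side involves [m], [D], [s] and [h]
    only through the integrals of [h] over [s]-preimages, so equality of these for two data forces
    equality of the limits. *)
Let ge0_integral_weight_lim d d' (Y : measurableType d) (Z : measurableType d')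
    (R : realType) (m : {measure set Y -> \bar R}) (D : set Y) (s : Y -> Z)
    (h : Y -> R) (phi : Z -> \bar R) (mphi : measurable_fun setT phi) :
  measurable D -> measurable_fun setT s -> measurable_fun D h ->
  (forall x, D x -> 0 <= h x)%R -> (forall z, 0 <= phi z) ->
  \int[m]_(x in D) ((h x)%:E * phi (s x)) =
  lim ((\sum_(r \in range (nnsfun_approx measurableT mphi n))
     (r%:E * \int[m]_(x in D `&` s @^-1`
        (nnsfun_approx measurableT mphi n @^-1` [set r])) (h x)%:E)) @[n --> \oo]).
Proof.
move=> mD ms mh h0 phi0; set f := nnsfun_approx measurableT mphi.
have mfs n : measurable_fun D (fun x => (f n (s x))).
  by apply: measurable_funTS; apply: measurableT_comp.
transitivity (lim (\int[m]_(x in D) ((h x)%:E * (f n (s x))%:E) @[n --> \oo])).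
  rewrite -monotone_convergence//.
  - apply: eq_integral => x /[!inE] Dx; apply/esym/cvg_lim => //.
    apply: cvgeZl => //.
    exact: (cvg_nnsfun_approx measurableT mphi (fun z _ => phi0 z)).
  - move=> n; apply: emeasurable_funM; exact/measurable_EFinP.
  - by move=> n x Dx; rewrite mule_ge0 ?lee_fin ?h0.
  - move=> x Dx a b ab; rewrite lee_wpmul2l ?lee_fin ?h0//.
    exact/lefP/nd_nnsfun_approx.
congr (limn _); apply/funext => n.
have mpre r : measurable (s @^-1` (f n @^-1` [set r])).
  by apply: measurable_preimageT => //; exact: measurable_sfunP.
transitivity (\int[m]_(x in D) (\sum_(r \in range (f n))
    (r%:E * ((h x)%:E * (\1_(f n @^-1` [set r]) (s x))%:E)))).
  apply: eq_integral => x /[!inE] Dx.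
  rewrite fimfunE -fsumEFin// ge0_mule_fsumr; last first.
    by move=> r; exact: nnfun_muleindic_ge0.
  by apply: eq_fsbigr => r _; rewrite EFinM muleCA.
have mi r : measurable_fun D (fun x => (h x)%:E * (\1_(f n @^-1` [set r]) (s x))%:E).
  apply: emeasurable_funM; apply/measurable_EFinP => //.
  by apply: measurable_funTS; apply: measurableT_comp.
have i0 r x : D x -> 0 <= (h x)%:E * (\1_(f n @^-1` [set r]) (s x))%:E.
  by move=> Dx; rewrite mule_ge0 ?lee_fin ?h0.
have r0 (r : R) x : D x -> 0 <= r%:E * ((h x)%:E * (\1_(f n @^-1` [set r]) (s x))%:E).
  move=> Dx; rewrite muleCA; apply: mule_ge0; first by rewrite lee_fin h0.
  exact: nnfun_muleindic_ge0.
rewrite ge0_integral_fsum//; last by move=> r; exact: measurable_funeM.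
apply: eq_fsbigr => r /[!inE] -[z _ <-].
rewrite ge0_integralZl_EFin//; last by move=> x Dx; exact: i0.
rewrite integral_mkcondr; congr (_ * _); apply: eq_integral => x _.
rewrite patchE indicE (_ : (x \in _) = (s x \in f n @^-1` [set f n z])).
  by case: ifP; rewrite ?mule1 ?mule0.
by apply/idP/idP; rewrite !inE.
Qed.

(* Instances: pushforwards (h1 = h2 = 1), restrictions to a set (s1 = s2 = id),
   measures with density h2 (s1 = s2 = id, h1 = 1). *)
Lemma ge0_integral_transfer d1 d2 d3 (Y1 : measurableType d1)
    (Y2 : measurableType d2) (Z : measurableType d3) (R : realType)
    (m1 : {measure set Y1 -> \bar R}) (m2 : {measure set Y2 -> \bar R})
    (D1 : set Y1) (D2 : set Y2) (s1 : Y1 -> Z) (s2 : Y2 -> Z)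
    (h1 : Y1 -> R) (h2 : Y2 -> R) (phi : Z -> \bar R) :
  measurable D1 -> measurable_fun setT s1 -> measurable_fun D1 h1 ->
  (forall x, D1 x -> 0 <= h1 x)%R ->
  measurable D2 -> measurable_fun setT s2 -> measurable_fun D2 h2 ->
  (forall x, D2 x -> 0 <= h2 x)%R ->
  measurable_fun setT phi -> (forall z, 0 <= phi z) ->
  (forall A, measurable A ->
    \int[m1]_(x in D1 `&` s1 @^-1` A) (h1 x)%:E =
    \int[m2]_(x in D2 `&` s2 @^-1` A) (h2 x)%:E) ->
  \int[m1]_(x in D1) ((h1 x)%:E * phi (s1 x)) =
  \int[m2]_(x in D2) ((h2 x)%:E * phi (s2 x)).
Proof.
move=> mD1 ms1 mh1 h10 mD2 ms2 mh2 h20 mphi phi0 H.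
rewrite !(ge0_integral_weight_lim _ mphi)//.
congr (limn _); apply/funext => n; apply: eq_fsbigr => r _.
by rewrite H//; exact: measurable_sfunP.
Qed.

End integral_transfer.

Section indep.
Local Open Scope ereal_scope.
Context d (Omega : measurableType d) (R : realType) (P : probability Omega R).

(** On rectangles the law of [(S, tau)] under [P] restricted to [D] is a product; uniqueness of
    product measures and Tonelli do the rest. Restricting [P] to [D], rather than conditioning on
    it, avoids dividing by [P D]. *)
Lemma ge0_integral_indep (D : set Omega) (S : Omega -> R) (tau : {RV P >-> R})
    (f : R * R -> \bar R) :
  measurable D -> measurable_fun setT S ->
  (forall A B, measurable A -> measurable B ->
    P (D `&` S @^-1` A `&` tau @^-1` B) =
    P (D `&` S @^-1` A) * P (tau @^-1` B)) ->
  measurable_fun setT f -> (forall z, 0 <= f z) ->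
  \int[P]_(w in D) f (S w, tau w) =
  \int[P]_(w in D) \int[distribution P tau]_x f (S w, x).
Proof.
move=> mD mS ind mf f0.
have mtau : measurable_fun setT tau by exact: measurable_funPT.
have mSt : measurable_fun setT (fun w => (S w, tau w)) by exact: measurable_fun_pair.
pose PD : {measure set Omega -> \bar R} := mrestr P mD.
pose m1 := measure_function_pushforward__canonical__measure_function_Measure PD mS.
pose m12 := measure_function_pushforward__canonical__measure_function_Measure PD mSt.
have m1E A : m1 A = P (D `&` S @^-1` A) by rewrite setIC.
have fin1 : fin_num_fun m1.
  move=> A mA; rewrite m1E; apply: fin_num_measure.
  by apply: measurableI => //; exact: measurable_preimageT.
pose m1i := @Measure_isFinite.Build _ _ _ m1 fin1.
pose m1f : {finite_measure set R -> \bar R} :=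
  HB.pack (Measure.sort m1) (Measure.class m1) m1i.
have prodE C : measurable C -> (m1f \x distribution P tau) C = m12 C.
  apply: product_measure_unique => A B mA mB.
  have -> : m12 (A `*` B) = P (D `&` S @^-1` A `&` tau @^-1` B).
    rewrite /m12 /pushforward /PD /mrestr /=; congr (P _).
    by apply/seteqP; split=> w /= [[]].
  by rewrite ind// -m1E.
transitivity (\int[m1f \x distribution P tau]_z f z).
  under eq_integral do rewrite -[f _]mul1e.
  under [RHS]eq_integral do rewrite -[f _]mul1e.
  apply: (ge0_integral_transfer (s1 := fun w => (S w, tau w)) (s2 := id)) => //.
  move=> A mA; rewrite !integral_cst//.
  - by rewrite setTI; have /= -> := prodE _ mA; rewrite setIC.
  - by rewrite setTI.
  - by apply: measurableI => //; exact: measurable_preimageT.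
rewrite fubini_tonelli1//.
have mF : measurable_fun setT (fubini_F (distribution P tau) f).
  exact: measurable_fun_fubini_tonelli_F.
under eq_integral do rewrite -[fubini_F _ _ _]mul1e.
under [RHS]eq_integral do rewrite -[integral _ _ _]mul1e.
apply: (ge0_integral_transfer (s1 := id) (s2 := S)
  (phi := fubini_F (distribution P tau) f)) => //.
  by move=> z; apply: integral_ge0.
move=> A mA; rewrite !integral_cst//.
- by rewrite setTI; congr (1 * _); exact: m1E.
- by apply: measurableI => //; exact: measurable_preimageT.
- by rewrite setTI.
Qed.

End indep.

(** * Exponential waiting times *)

Section expo.
Local Open Scope ereal_scope.
Context (R : realType).
Notation mu := (@lebesgue_measure R).

Lemma set_itv0c_setI (t : R) :
  `[0%R, t]%classic = `]-oo, t]%classic `&` `[0%R, +oo[%classic.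
Proof.
by apply/seteqP; split => y /=; rewrite !in_itv/= ?andbT;
  [move=> /andP[-> ->]|move=> [-> ->]].
Qed.

Lemma lebesgue_measure_translation (c : R) (A : set R) : measurable A ->
  mu ((fun x : R => (x + c)%R) @^-1` A) = mu A.
Proof.
have mc : measurable_fun setT
    (fun x : measurableTypeR R => (x + c)%R : measurableTypeR R).
  exact: measurable_funD.
move=> mA; apply/esym/(@lebesgue_measure_unique _
  (measure_function_pushforward__canonical__measure_function_Measure mu mc))
  => //= _ [[a b]] _ <-.
rewrite /pushforward (_ : _ @^-1` _ = `](a - c)%R, (b - c)%R]%classic); last first.
  by apply/seteqP; split=> x /=; rewrite !in_itv/= ltrBlDr lerBrDr.
rewrite !lebesgue_measure_itv/= !lte_fin ltrD2r.
by case: ifP => // _; congr EFin; rewrite opprB addrA subrK.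
Qed.

Lemma ge0_integral_translation (c : R) (f : R -> \bar R) :
  measurable_fun setT f -> (forall x, 0 <= f x) ->
  \int[mu]_x f (x + c)%R = \int[mu]_x f x.
Proof.
move=> mf f0.
under eq_integral do rewrite -[f _]mul1e.
under [RHS]eq_integral do rewrite -[f _]mul1e.
have mc : measurable_fun setT (fun x : R => (x + c)%R) by exact: measurable_funD.
apply: (@ge0_integral_transfer _ _ _ _ _ _ R mu mu setT setT
  (fun x => (x + c)%R) id (cst 1%R) (cst 1%R) f) => //.
move=> A mA; rewrite !setTI.
rewrite (integral_cst mu (measurable_preimageT mc mA) 1) (integral_cst mu mA 1).
by congr (_ * _); exact: lebesgue_measure_translation.
Qed.

Variable lambda : R.
Hypothesis lambda0 : (0 < lambda)%R.

(** Probability that a waiting time begun at [s] covers [t]. With the value 0 for [s > t] it is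
    also, up to the factor [lambda], the density at [t] of the end of that waiting time;
    [compensator] rests on this coincidence. *)
Definition survival (t s : R) : R :=
  if (s <= t)%R then expR (- lambda * (t - s)) else 0%R.

Lemma survival_ge0 t s : (0 <= survival t s)%R.
Proof. by rewrite /survival; case: ifP => // _; exact: expR_ge0. Qed.

Lemma exponential_pdfB t s :
  exponential_pdf lambda (t - s)%R = (lambda * survival t s)%R.
Proof.
rewrite /survival; case: (leP s t) => st.
  by rewrite exponential_pdfE// subr_ge0.
by rewrite lt0_exponential_pdf ?mulr0// subr_lt0.
Qed.

Lemma measurable_survival :
  measurable_fun setT (fun z : R * R => survival z.1 z.2).
Proof.
rewrite (_ : (fun _ => _) = (fun z : R * R =>
    lambda^-1 * exponential_pdf lambda (z.1 - z.2))%R); last first.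
  by apply/funext => z; rewrite exponential_pdfB mulrA mulVf ?mul1r// gt_eqF.
apply: measurable_funM => //.
apply: measurableT_comp; first exact: measurable_exponential_pdf.
exact: measurable_funB.
Qed.

Section variable.
Context d (Omega : measurableType d) (P : probability Omega R).
Variable tau : {RV P >-> R}.
Hypothesis tauE : forall B, measurable B ->
  distribution P tau B = exponential_prob lambda B.

Lemma ge0_integral_exponential (phi : R -> \bar R) :
  measurable_fun setT phi -> (forall x, 0 <= phi x) ->
  \int[distribution P tau]_x phi x =
  \int[mu]_x ((exponential_pdf lambda x)%:E * phi x).
Proof.
move=> mphi phi0; under eq_integral do rewrite -[phi _]mul1e.
apply: (@ge0_integral_transfer _ _ _ _ _ _ R (distribution P tau) mu setT setT
  id id (cst 1%R) (exponential_pdf lambda) phi) => //.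
- exact: measurable_exponential_pdf.
- by move=> x _; exact/exponential_pdf_ge0/ltW.
- move=> A mA; rewrite !setTI (integral_cst (distribution P tau) mA 1) mul1e preimage_id.
  exact: tauE.
Qed.

Lemma exponential_tail (x : R) : (0 <= x)%R ->
  P (tau @^-1` `]x, +oo[%classic) = (expR (- lambda * x))%:E.
Proof.
move=> x0.
have -> : tau @^-1` `]x, +oo[%classic = ~` (tau @^-1` `]-oo, x]%classic).
  by apply/seteqP; split=> w /=; rewrite !in_itv/= andbT ltNge => /negP.
rewrite probability_setC; last exact: measurable_preimageT.
have -> : P (tau @^-1` `]-oo, x]%classic) = exponential_prob lambda `[0%R, x]%classic.
  rewrite -[LHS]/(distribution P tau _) tauE//.
  rewrite /exponential_prob set_itv0c_setI integral_mkcondr; apply: eq_integral => y _.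
  by rewrite patchE; case: ifPn => // /negbTE yN; rewrite /exponential_pdf patchE yN.
move: x0; rewrite le_eqVlt => /predU1P[<-|x0].
  by rewrite set_itv1 /exponential_prob integral_set1 mulr0 expR0 sube0.
by rewrite exponential_prob_itv0c// fin_num_oppeB// addeA subee// add0e.
Qed.

End variable.
End expo.

Lemma ge0_integral_mrestr d (Y : measurableType d) (R : realType)
    (m : {measure set Y -> \bar R}) (D : set Y) (mD : measurable D)
    (f : Y -> \bar R) :
  measurable_fun setT f -> (forall x, 0 <= f x)%E ->
  (\int[mrestr m mD]_x f x = \int[m]_(x in D) f x)%E.
Proof.
move=> mf f0; under [LHS]eq_integral do rewrite -[f _]mul1e.
under [RHS]eq_integral do rewrite -[f _]mul1e.
apply: (@ge0_integral_transfer _ _ _ _ _ _ R (mrestr m mD) m setT D id id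
  (cst 1) (cst 1) f) => // A mA.
rewrite setTI (integral_cst (mrestr m mD) mA 1).
by rewrite (integral_cst m (measurableI _ _ mD mA) 1) setIC.
Qed.

(** * Density of the next move time *)

Section compensator.
Local Open Scope ereal_scope.
Context (R : realType).
Notation mu := (@lebesgue_measure R).
Variable lambda : R.
Hypothesis lambda0 : (0 < lambda)%R.
Context d (Omega : measurableType d) (P : probability Omega R).
Variables (tau : {RV P >-> R}) (D : set Omega) (S : Omega -> R).
Hypothesis tauE : forall B, measurable B ->
  distribution P tau B = exponential_prob lambda B.
Hypothesis mD : measurable D.
Hypothesis mS : measurable_fun setT S.
Hypothesis ind : forall A B, measurable A -> measurable B ->
  P (D `&` S @^-1` A `&` tau @^-1` B) = P (D `&` S @^-1` A) * P (tau @^-1` B).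

Let mSt : measurable_fun setT (fun w => S w + tau w)%R.
Proof. by apply: measurable_funD => //; exact: measurable_funPT. Qed.

Lemma measurable_sojourn t : measurable [set w | (S w <= t < S w + tau w)%R].
Proof.
rewrite (_ : [set w | _] = S @^-1` `]-oo, t]%classic `&`
    (fun w => S w + tau w)%R @^-1` `]t, +oo[%classic).
  by apply: measurableI; exact: measurable_preimageT.
by apply/seteqP; split => w /=; rewrite !in_itv/= andbT; [move=> /andP|move=> [-> ->]].
Qed.

Lemma probability_sojourn t :
  P (D `&` [set w | (S w <= t < S w + tau w)%R]) =
  \int[P]_(w in D) (survival lambda t (S w))%:E.
Proof.
pose T : set (R * R) := [set z | (z.1 <= t < z.1 + z.2)%R].
have mT : measurable T.
  rewrite (_ : T = fst @^-1` `]-oo, t]%classic `&`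
      (fun z : R * R => z.1 + z.2)%R @^-1` `]t, +oo[%classic).
    by apply: measurableI; apply: measurable_preimageT => //; exact: measurable_funD.
  by apply/seteqP; split => w /=; rewrite /T/= !in_itv/= andbT; [move=> /andP|move=> [-> ->]].
transitivity (\int[P]_(w in D) (\1_T (S w, tau w))%:E).
  rewrite setIC -integral_indic//; exact: measurable_sojourn.
rewrite (ge0_integral_indep (f := EFin \o \1_T))//; last 2 first.
- exact/measurable_EFinP/measurable_indic.
- by move=> z /=; rewrite lee_fin.
apply: eq_integral => w _ /=.
have mTw : measurable [set x | T (S w, x)].
  rewrite -[X in measurable X]/((fun x => (S w, x)) @^-1` T).
  apply: measurable_preimageT => //.
  exact: pair1_measurable.
transitivity (P (tau @^-1` [set x | T (S w, x)])).
  rewrite -[RHS]/(distribution P tau _) -[X in distribution P tau X]setIT.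
  by rewrite -integral_indic.
rewrite /survival; case: (leP (S w) t) => St; last first.
  rewrite (_ : _ @^-1` _ = set0) ?measure0//.
  by apply/seteqP; split => // x; rewrite /T /= leNgt St.
rewrite -(exponential_tail tauE) ?subr_ge0//.
by congr (P _); apply/seteqP; split => x; rewrite /T /= in_itv/= St andbT /= ltrBlDl.
Qed.

(** Given [S], the density of [S + tau] at [t] is [lambda * survival lambda t S], and the mean of
    [survival lambda t S] over [D] is the probability of the sojourn by [probability_sojourn].
    Tonelli exchanges the two integrals. *)
Lemma compensator (phi : R -> \bar R) :
  measurable_fun setT phi -> (forall t, 0 <= phi t) ->
  \int[P]_(w in D) phi (S w + tau w)%R =
  \int[mu]_t (lambda%:E *
    (phi t * P (D `&` [set w | (S w <= t < S w + tau w)%R]))).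
Proof.
move=> mphi phi0.
have msurv t : measurable_fun setT (fun w => survival lambda t (S w)).
  apply: (measurableT_comp (f := fun z => survival lambda z.1 z.2)
    (g := fun w => (t, S w))); first exact: measurable_survival.
  exact: measurable_fun_pair.
pose F (z : Omega * R) : \bar R := (lambda * survival lambda z.2 (S z.1))%:E * phi z.2.
have mF : measurable_fun setT F.
  apply: emeasurable_funM; last exact: measurableT_comp.
  apply/measurable_EFinP/measurable_funM => //.
  apply: (measurableT_comp (f := fun z => survival lambda z.1 z.2)
    (g := fun w => (w.2, S w.1))); first exact: measurable_survival.
  by apply: measurable_fun_pair => //; exact: measurableT_comp.
have F0 z : 0 <= F z.
  by rewrite mule_ge0// lee_fin mulr_ge0 ?survival_ge0// ltW.
transitivity (\int[P]_(w in D) \int[mu]_t F (w, t)).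
  rewrite (ge0_integral_indep (f := fun z => phi (z.1 + z.2)%R))//; last first.
    by apply: measurableT_comp => //; exact: measurable_funD.
  apply: eq_integral => w _ /=.
  have mw : measurable_fun setT (fun t => F (w, t)).
    by apply: (measurableT_comp mF); exact: pair1_measurable.
  rewrite (ge0_integral_exponential lambda0 tauE)//; last first.
    by apply: measurableT_comp => //; exact: measurable_funD.
  (* Change of variable from the waiting time [x] to the absolute time [x + S w]. *)
  rewrite -(ge0_integral_translation (S w) mw)//.
  apply: eq_integral => x _; rewrite /F /=.
  by rewrite -exponential_pdfB// addrK addrC.
have mFt : measurable_fun setT (fubini_F mu F) by exact: measurable_fun_fubini_tonelli_F.
rewrite -(ge0_integral_mrestr P mD mFt); last by move=> w; exact: integral_ge0.
rewrite (fubini_tonelli (m1 := mrestr P mD) (m2 := mu) F mF F0).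
apply: eq_integral => t _; rewrite /fubini_G.
rewrite (ge0_integral_mrestr P mD (f := fun x => F (x, t)))//; last first.
  by apply: (measurableT_comp mF); exact: pair2_measurable.
rewrite probability_sojourn.
under eq_integral do rewrite /F /= muleC EFinM muleA.
rewrite ge0_integralZl//.
- by rewrite muleA [phi t * _]muleC.
- by apply/measurable_funTS/measurable_EFinP.
- by move=> w _; rewrite lee_fin survival_ge0.
- by rewrite mule_ge0// lee_fin ltW.
Qed.

End compensator.

(** * Independence of the future waiting times *)

Section future.
Local Open Scope ereal_scope.
Context d (Omega : measurableType d) (R : realType) (P : probability Omega R).
Variable tau : nat -> {RV P >-> R}.

Lemma move_time0 w : move_time tau 0 w = 0%R.
Proof. by rewrite /move_time big_geq. Qed.

Lemma move_timeS n w : move_time tau n.+1 w = (move_time tau n w + tau n w)%R.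
Proof. by rewrite /move_time big_nat_recr. Qed.

Lemma measurable_move_time n : measurable_fun setT (move_time tau n).
Proof. by apply: measurable_sum => k; exact: measurable_funPT. Qed.

Definition cylinder (s : seq nat) (B : nat -> set R) : set Omega :=
  \bigcap_(k in [set` s]) (tau k @^-1` B k).

Lemma cylinder_nil B : cylinder [::] B = setT.
Proof. by rewrite /cylinder set_nil bigcap_set0. Qed.

Lemma cylinder_cons n s B :
  cylinder (n :: s) B = tau n @^-1` B n `&` cylinder s B.
Proof.
apply/seteqP; split=> w.
  move=> H; split; first by apply: H; rewrite /= mem_head.
  by move=> k /= ks; apply: H; rewrite /= inE ks orbT.
move=> [Hn H] k /=; rewrite inE => /predU1P[->//|]; exact: H.
Qed.

Lemma measurable_cylinder s B : (forall k, measurable (B k)) ->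
  measurable (cylinder s B).
Proof.
move=> mB; apply: fin_bigcap_measurable => // k _.
by apply: measurable_preimageT => //; exact: measurable_funPT.
Qed.

Lemma eq_cylinder s B B' : {in s, B =1 B'} -> cylinder s B = cylinder s B'.
Proof. by move=> BB'; apply: eq_bigcapr => k /= ks; rewrite BB'. Qed.

(* Finitely many future waiting times suffice: with the whole future sigma-algebra
   the induction on n would need another monotone class argument. *)
Definition indep_future n (D : set Omega) :=
  forall A s B, measurable A -> uniq s -> all (fun k => n <= k)%N s ->
    (forall k, measurable (B k)) ->
  P (D `&` move_time tau n @^-1` A `&` cylinder s B) =
  P (D `&` move_time tau n @^-1` A) * \prod_(k <- s) P (tau k @^-1` B k).

Lemma indep_future_setC n D : measurable D -> indep_future n setT ->
  indep_future n D -> indep_future n (~` D).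
Proof.
move=> mD iT iD A s B mA us ns mB.
have mSA : measurable (move_time tau n @^-1` A).
  by apply: measurable_preimageT => //; exact: measurable_move_time.
have mC := measurable_cylinder s mB.
have setCE E : measurable E -> P (~` D `&` E) = P E - P (D `&` E).
  move=> mE; rewrite setIC -setDE measureD 1?setIC//.
  by rewrite -ge0_fin_numE// fin_num_measure.
rewrite -setIA setCE; last exact: measurableI.
rewrite setCE// setIA iD//.
have := iT A s B mA us ns mB; rewrite !setTI => ->.
rewrite muleBl//; last first.
  by rewrite fin_num_adde_defr// fin_num_measure.
apply: prode_fin_num => k _; apply: fin_num_measure.
by apply: measurable_preimageT => //; exact: measurable_funPT.
Qed.

Lemma indep_future_indep n D : indep_future n D ->
  forall A B, measurable A -> measurable B ->
  P (D `&` move_time tau n @^-1` A `&` tau n @^-1` B) =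
  P (D `&` move_time tau n @^-1` A) * P (tau n @^-1` B).
Proof.
move=> iD A B mA mB.
have := iD A [:: n] (fun=> B) mA isT _ (fun=> mB).
by rewrite cylinder_cons cylinder_nil setIT big_seq1 => -> //=; rewrite leqnn.
Qed.

(** Conditions on the waiting times after [tau n] can be absorbed into [D], so that [tau n] can be
    integrated out while they are kept. *)
Lemma indep_futureI n D s B : indep_future n D -> uniq s ->
    all (fun k => n.+1 <= k)%N s -> (forall k, measurable (B k)) ->
  forall A B', measurable A -> measurable B' ->
  P (D `&` cylinder s B `&` move_time tau n @^-1` A `&` tau n @^-1` B') =
  P (D `&` cylinder s B `&` move_time tau n @^-1` A) * P (tau n @^-1` B').
Proof.
move=> iD us ns mB A B' mA mB'.
have ns' : all (fun k => n <= k)%N s.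
  by apply: sub_all ns => k; exact: ltnW.
(* [B''] adds the condition on [tau n] to the family [B], so that one cylinder over [n :: s]
   expresses both. *)
pose B'' k := if k == n then B' else B k.
have nNs : n \notin s by apply/negP => /(allP ns); rewrite ltnn.
have BB'' : {in s, B =1 B''}.
  by move=> k ks; rewrite /B''; case: eqP => // kn; rewrite -kn ks in nNs.
have B''n : B'' n = B' by rewrite /B'' eqxx.
rewrite [D `&` _ `&` move_time _ _ @^-1` _]setIAC iD//.
rewrite (eq_cylinder BB'').
have -> : D `&` move_time tau n @^-1` A `&` cylinder s B'' `&` tau n @^-1` B' =
    D `&` move_time tau n @^-1` A `&` cylinder (n :: s) B''.
  by rewrite cylinder_cons B''n -!setIA; do 2 congr (_ `&` _); rewrite setIC.
rewrite iD//=; last 3 first.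
- by rewrite nNs.
- by rewrite leqnn.
- by move=> k; rewrite /B''; case: ifP.
rewrite big_cons B''n muleCA muleC; congr (_ * _ * _).
by apply: eq_big_seq => k ks; rewrite BB''.
Qed.

(** [K] is the conditional probability of passing from [D] to [D'] at move [n.+1], as a function of
    the time of that move. Integrating [tau n] out leaves a function of [move_time tau n] on [D] and
    the cylinder, and the independence at stage [n] splits the cylinder off. *)
Lemma indep_future_step n (D D' : set Omega) (K : R -> R) :
  measurable D -> measurable D' -> indep_future n D ->
  measurable_fun setT K -> (forall t, 0 <= K t)%R ->
  (forall A s B, measurable A -> (forall k, measurable (B k)) ->
    P (D' `&` move_time tau n.+1 @^-1` A `&` cylinder s B) =
    \int[P]_(w in D `&` cylinder s B `&` move_time tau n.+1 @^-1` A)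
      (K (move_time tau n.+1 w))%:E) ->
  indep_future n.+1 D'.
Proof.
move=> mD mD' iD mK K0 DD' A s B mA us ns mB.
have mtau k : measurable_fun setT (tau k) by exact: measurable_funPT.
pose phi t := (K t * \1_A t)%:E.
have mphi : measurable_fun setT phi.
  by apply/measurable_EFinP/measurable_funM => //; exact: measurable_indic.
have phi0 t : 0 <= phi t by rewrite lee_fin mulr_ge0.
have mphi2 : measurable_fun setT (fun z : R * R => phi (z.1 + z.2)%R).
  by apply: measurableT_comp => //; exact: measurable_funD.
(* [H t] is the mean of [phi] at the next move time when the [n]-th move occurs at [t]. *)
pose H t := \int[distribution P (tau n)]_x phi (t + x)%R.
have mH : measurable_fun setT H.
  exact: (measurable_fun_fubini_tonelli_F (m2 := distribution P (tau n))
    (fun z : R * R => phi (z.1 + z.2)%R)).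
have H0 t : 0 <= H t by exact: integral_ge0.
have stepE s' B' : uniq s' -> all (fun k => n < k)%N s' ->
    (forall k, measurable (B' k)) ->
    P (D' `&` move_time tau n.+1 @^-1` A `&` cylinder s' B') =
    \int[P]_(w in D `&` cylinder s' B') H (move_time tau n w).
  move=> us' ns' mB'; rewrite DD'// integral_mkcondr.
  transitivity (\int[P]_(w in D `&` cylinder s' B') phi (move_time tau n w + tau n w)%R).
    apply: eq_integral => w _.
    rewrite patchE /phi -move_timeS indicE.
    rewrite (_ : (w \in _) = (move_time tau n.+1 w \in A)); last first.
      by apply/idP/idP; rewrite !inE.
    by case: ifP; rewrite ?mulr1 ?mulr0.
  rewrite (ge0_integral_indep (f := fun z => phi (z.1 + z.2)%R))//.
  - by apply: measurableI => //; exact: measurable_cylinder.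
  - exact: measurable_move_time.
  - exact: indep_futureI.
have := stepE [::] (fun=> setT) isT isT (fun=> measurableT).
rewrite cylinder_nil !setIT => ->.
rewrite stepE//.
pose c := \prod_(k <- s) P (tau k @^-1` B k).
have c0 : 0 <= c by apply: prode_ge0 => *; exact: measure_ge0.
have cfin : c \is a fin_num.
  by apply: prode_fin_num => k _; apply: fin_num_measure; exact: measurable_preimageT.
have mDC : measurable (D `&` cylinder s B).
  by apply: measurableI => //; exact: measurable_cylinder.
have ns' : all (fun k => n <= k)%N s by apply: sub_all ns => k; exact: ltnW.
transitivity (\int[P]_(w in D) ((fine c)%:E * H (move_time tau n w))); last first.
  rewrite ge0_integralZl//.
  - by rewrite fineK// muleC.
  - apply: measurable_funTS; apply: measurableT_comp => //.
    exact: measurable_move_time.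
  - by rewrite fineK.
under eq_integral do rewrite -[H _]mul1e.
have mS := measurable_move_time n.
(* The probability [c] of the cylinder serves as a constant weight, so that only preimages under
   [move_time tau n] remain to be compared, which is [iD]. *)
apply: (@ge0_integral_transfer _ _ _ _ _ _ R P P (D `&` cylinder s B) D
  (move_time tau n) (move_time tau n) (cst 1%R) (cst (fine c)) H) => //.
  by move=> w _; rewrite fine_ge0.
move=> A' mA'.
have mSA' := measurable_preimageT mS mA'.
rewrite (integral_cst P (measurableI _ _ mDC mSA') 1).
rewrite (integral_cst P (measurableI _ _ mD mSA') (fine c)%:E).
rewrite mul1e setIAC; apply: (etrans (iD _ _ _ mA' us ns' mB)).
by rewrite fineK// muleC.
Qed.

End future.

(** * Jumps to v_1 *)

Section jump_rate.
Variables (R : realType) (k0 : nat).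

Definition jump_rate (s : R) : R := (k0 + Num.truncn s).-1%:R^-1.

Lemma jump_rate_ge0 s : 0 <= jump_rate s.
Proof. by rewrite invr_ge0. Qed.

Lemma measurable_truncn : measurable_fun setT (fun s : R => (Num.truncn s)%:R : R).
Proof. by apply: nondecreasing_measurable => // s t st; rewrite ler_nat le_truncn. Qed.

Lemma measurable_jump_rate : (2 <= k0)%N -> measurable_fun setT jump_rate.
Proof.
(* [jump_rate] is nonincreasing; the double opposite exhibits it as the opposite of a monotone
   function of the required direction. *)
move=> k2; rewrite (_ : jump_rate = (fun s => - - jump_rate s)); last first.
  by apply/funext => s; rewrite opprK.
apply: measurableT_comp => //; apply: nondecreasing_measurable => // s t st.
have p u : (0 < (k0 + u).-1)%N.
  by case: k0 k2 => [|[|k]].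
rewrite lerN2 lef_pV2 ?posrE ?ltr0n// ler_nat.
rewrite -ltnS !prednK ?ltnS ?leq_add2l ?le_truncn//;
  by rewrite (leq_trans _ (leq_addr _ _))// (ltn_trans _ k2).
Qed.

Lemma mem_present (s : R) y :
  (y \in present k0 s) = (0 < y)%N && (y%:R - k0%:R <= (Num.truncn s)%:R :> R).
Proof. by rewrite mem_iota add1n ltnS lerBlDl -natrD ler_nat. Qed.

Lemma measurable_present y : measurable [set s : R | y \in present k0 s].
Proof.
case: (posnP y) => [->|y0].
  by rewrite (_ : [set _ | _] = set0)//; apply/seteqP; split => s //=; rewrite mem_present.
rewrite (_ : [set _ | _] =
    (fun s : R => (Num.truncn s)%:R : R) @^-1` `[y%:R - k0%:R, +oo[%classic).
  exact: measurable_preimageT measurable_truncn _.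
by apply/seteqP; split => s /=; rewrite mem_present y0 in_itv/= andbT.
Qed.

Lemma sub_present (s t : R) : s <= t -> {subset present k0 s <= present k0 t}.
Proof.
move=> st y; rewrite !mem_present => /andP[-> /le_trans]; apply.
by rewrite ler_nat le_truncn.
Qed.

(** The presence of [x] matters: only then does removing it lower the number of vertices by one,
    giving the same value for all [x] other than v_1. *)
Lemma jump_prob_v1 (s : R) x : (0 < k0)%N -> x \in present k0 s ->
  jump_prob k0 s x 1 = if x == 1%N then 0 else jump_rate s.
Proof.
move=> k00 xs; rewrite /jump_prob mem_filter eq_sym; case: eqP => //= x1.
rewrite mem_present/= lerBlDl -natrD ler_nat ltn_addr//.
rewrite /jump_rate; congr (_%:R^-1).
have := count_predC (pred1 x) (present k0 s).
rewrite size_iota count_uniq_mem ?iota_uniq// xs => <-.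
by rewrite size_filter.
Qed.

Lemma jump_prob_notin (s : R) x y : y \notin present k0 s -> jump_prob k0 s x y = 0.
Proof. by move=> ys; rewrite /jump_prob mem_filter (negbTE ys) andbF. Qed.

End jump_rate.

Section history.
Context d (Omega : measurableType d) (R : realType) (P : probability Omega R).
Variables (tau : nat -> {RV P >-> R}) (X : nat -> {RV P >-> nat}).

Let gen n := [set A | (exists k (B : set R), measurable B /\ A = tau k @^-1` B) \/
               (exists m (B : set nat), [/\ (m <= n)%N, measurable B &
                                            A = X m @^-1` B])].

Let measurable_tau n k :
  measurable_fun setT (tau k : g_sigma_algebraType (gen n) -> R).
Proof.
by move=> _ B mB; rewrite setTI; apply: sub_sigma_algebra; left; exists k, B.
Qed.

(** The history contains every waiting time, hence [m] may exceed [n]: jumps are conditioned on the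
    time [move_time tau n.+1] at which they occur. *)
Lemma history_move_time n m A : measurable A ->
  history tau X n (move_time tau m @^-1` A).
Proof.
move=> mA; have mS : measurable_fun setT
    (move_time tau m : g_sigma_algebraType (gen n) -> R).
  exact: measurable_sum.
exact: (measurable_preimageT mS mA).
Qed.

Lemma history_cylinder n s B : (forall k, measurable (B k)) ->
  history tau X n (cylinder tau s B).
Proof.
move=> mB.
apply: (@fin_bigcap_measurable _ (g_sigma_algebraType (gen n))) => // k _.
by apply: sub_sigma_algebra; left; exists k, (B k).
Qed.

Lemma historyI n A B : history tau X n A -> history tau X n B ->
  history tau X n (A `&` B).
Proof. exact: (@measurableI _ (g_sigma_algebraType (gen n))). Qed.

Lemma history_measurable n A : history tau X n A -> measurable A.
Proof.
apply: smallest_sub; first exact: sigma_algebra_measurable.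
move=> _ [[k [B [mB ->]]]|[m [B [_ mB ->]]]].
  by apply: measurable_preimageT => //; exact: measurable_funPT.
by apply: measurable_preimageT => //; exact: measurable_funPT.
Qed.

End history.

Section walk.
Context d (Omega : measurableType d) (R : realType) (P : probability Omega R).
Variables (k0 : nat) (lambda : R).
Variables (tau : nat -> {RV P >-> R}) (X : nat -> {RV P >-> nat}).
Hypothesis k02 : (2 <= k0)%N.
Hypothesis walk : growing_complete_walk k0 lambda tau X.

Definition at_v1 n : set Omega := X n @^-1` [set 1%N].

Lemma measurable_at_v1 n : measurable (at_v1 n).
Proof. by apply: measurable_preimageT => //; exact: measurable_funPT. Qed.

Lemma ae_tau_ge0 : {ae P, forall w, forall k, 0 <= tau k w}.
Proof.
apply: ae_foralln => k.
exists (tau k @^-1` `]-oo, 0[%classic); split.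
- by apply: measurable_preimageT => //; exact: measurable_funPT.
- rewrite -[LHS]/(distribution P (tau k) _) (walk_exponential walk)//.
  rewrite /exponential_prob integral0_eq// => x /=; rewrite in_itv/= => x0.
  by rewrite lt0_exponential_pdf.
- by move=> w /=; rewrite in_itv/= ltNge => /negP.
Qed.

Lemma move_time_nondecreasing (w : Omega) : (forall k, 0 <= tau k w) ->
  {homo (fun n => move_time tau n w) : m n / (m <= n)%N >-> m <= n}.
Proof.
move=> tau0; apply: homo_leq => [//|x y z|n]; first exact: le_trans.
by rewrite move_timeS lerDl.
Qed.

Lemma move_time_ge0 (w : Omega) n : (forall k, 0 <= tau k w) -> 0 <= move_time tau n w.
Proof. by move=> tau0; apply: sumr_ge0 => k _. Qed.

(** The jump law gives weight 0 to absent vertices, and there are countably many labels. This makes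
    [jump_prob_v1] applicable almost surely. *)
Lemma ae_present :
  {ae P, forall w, forall n, X n w \in present k0 (move_time tau n w)}.
Proof.
apply: ae_foralln => -[|n].
  apply: aeW => w /=; rewrite (walk_start walk) mem_present/= lerBlDl -natrD ler_nat.
  by rewrite ltn_addr// ltnW.
pose N y := move_time tau n.+1 @^-1` [set s : R | y \notin present k0 s] `&`
  X n.+1 @^-1` [set y].
have mN y : measurable [set s : R | y \notin present k0 s].
  rewrite (_ : [set _ | _] = ~` [set s : R | y \in present k0 s]); last first.
    by apply/seteqP; split => s /= /negP.
  by apply: measurableC; exact: measurable_present.
apply: (@negligibleS _ _ _ _ (\bigcup_y N y)).
  by move=> w /= /negP Xw; exists (X n.+1 w).
apply: negligible_bigcup => y; apply/negligibleP.
  apply: measurableI; apply: measurable_preimageT => //.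
    exact: (measurable_move_time tau).
have e := walk_jump walk y (@history_move_time _ _ _ _ tau X n n.+1 _ (mN y)).
apply: (eq_trans e).
by rewrite integral0_eq// => w /= yw; rewrite jump_prob_notin.
Qed.

Lemma leq_size_neighbours x (s t : R) : s <= t ->
  (size (neighbours k0 s x) <= size (neighbours k0 t x))%N.
Proof.
move=> st; rewrite /neighbours !size_filter.
rewrite /present -(subnKC (le_truncn st)) addnA.
rewrite (iotaD _ (k0 + Num.truncn s)) count_cat.
exact: leq_addr.
Qed.

Lemma measurable_jump_prob x :
  measurable_fun setT (fun s : R => jump_prob k0 s x 1).
Proof.
have [->|x1] := eqVneq x 1%N.
  rewrite (_ : (fun _ => _) = cst 0)//; apply/funext => s.
  by rewrite /jump_prob mem_filter eqxx.
pose c (s : R) := (size (neighbours k0 s x))%:R : R.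
have mc : measurable_fun setT c.
  apply: nondecreasing_measurable => // s t st; rewrite ler_nat.
  exact: leq_size_neighbours.
have c0 s : 0 < c s.
  rewrite ltr0n size_filter -has_count; apply/hasP; exists 1%N => /=.
    by rewrite mem_iota/= add1n ltnS ltn_addr// ltnW.
  by rewrite eq_sym.
rewrite (_ : (fun _ => _) = (fun s => - - (c s)^-1)); last first.
  apply/funext => s; rewrite opprK /jump_prob mem_filter eq_sym x1 mem_iota/=.
  by rewrite add1n ltnS ltn_addr// ltnW.
apply: measurableT_comp => //; apply: nondecreasing_measurable => // s t st.
rewrite lerN2 lef_pV2 ?posrE ?c0// ler_nat.
exact: leq_size_neighbours.
Qed.

(** The walk reduces to two states: the jump probability to v_1 is 0 from v_1 and [jump_rate] from
    any other vertex. The latter holds almost surely, since the current vertex must be present at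
    the time of the jump. *)
Lemma walk_jump_v1 n (A : set Omega) : history tau X n A ->
  P (A `&` at_v1 n.+1) =
  (\int[P]_(w in A `&` ~` at_v1 n) (jump_rate k0 (move_time tau n.+1 w))%:E)%E.
Proof.
move=> hA; rewrite (walk_jump walk 1 hA).
have mA := history_measurable hA.
have mS := measurable_move_time tau n.+1.
have mj : measurable_fun setT (fun w => jump_rate k0 (move_time tau n.+1 w)).
  apply: measurableT_comp; first exact: measurable_jump_rate.
  exact: measurable_move_time.
rewrite integral_mkcondr; apply: ge0_ae_eq_integral => //.
- apply: measurable_funTS; apply/measurable_EFinP.
  (* The position has countably many values; for each of them a function of the move time alone
     remains. *)
  move=> _ B mB; rewrite setTI (_ : _ @^-1` _ = \bigcup_x (X n @^-1` [set x] `&`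
      move_time tau n.+1 @^-1` ((fun s => jump_prob k0 s x 1) @^-1` B))); last first.
    by apply/seteqP; split => [w /= wB|w [x _ [/= -> //]]]; exists (X n w).
  apply: bigcupT_measurable => x; apply: measurableI.
    by apply: measurable_preimageT => //; exact: measurable_funPT.
  apply: (measurable_preimageT mS); apply: measurable_preimageT => //.
  exact: measurable_jump_prob.
- apply/(measurable_restrict _ (measurableC (measurable_at_v1 n)) mA).
  by apply: measurable_funTS; exact/measurable_EFinP.
- by move=> w _; rewrite lee_fin /jump_prob; case: ifP.
- by move=> w _; rewrite patchE; case: ifP => // _; rewrite lee_fin jump_rate_ge0.
- apply: filterS2 ae_tau_ge0 ae_present => w tau0 pw Aw.
  rewrite jump_prob_v1; last first.
  - exact: (sub_present (move_time_nondecreasing tau0 (leqnSn n))).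
  - exact: ltnW.
  rewrite patchE (_ : (w \in _) = (X n w != 1%N)); first by case: eqP.
  by rewrite in_setC /at_v1; congr (~~ _); apply/idP/eqP; rewrite inE.
Qed.

End walk.

(** * Sojourn probabilities *)

Section recursion.
Context d (Omega : measurableType d) (R : realType) (P : probability Omega R).
Variables (k0 : nat) (lambda : R).
Variables (tau : nat -> {RV P >-> R}) (X : nat -> {RV P >-> nat}).
Hypothesis k02 : (2 <= k0)%N.
Hypothesis lambda0 : 0 < lambda.
Hypothesis walk : growing_complete_walk k0 lambda tau X.
Local Open Scope ereal_scope.
Notation mu := (@lebesgue_measure R).
Notation S := (move_time tau).
Notation V := (at_v1 X).

Lemma indep_future_setT n : indep_future tau n setT.
Proof.
elim: n => [|n IHn].
  move=> A s B mA us _ mB; rewrite !setTI.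
  have [A0|A0] := pselect (A 0%R).
    rewrite (_ : S 0 @^-1` A = setT); last first.
      by apply/seteqP; split => w //= _; rewrite move_time0.
    by rewrite setTI probability_setT mul1e; exact: (walk_independent walk).
  rewrite (_ : S 0 @^-1` A = set0); last first.
    by apply/seteqP; split => w //=; rewrite move_time0.
  by rewrite set0I measure0 mul0e.
apply: (indep_future_step (D := setT) (K := cst 1%R)) => // A s B mA mB.
rewrite !setTI (integral_cst P _ 1) ?mul1e.
  by rewrite setIC.
apply: measurableI; first exact: measurable_cylinder.
by apply: measurable_preimageT => //; exact: measurable_move_time.
Qed.

Lemma indep_future_at_v1 n : indep_future tau n (V n).
Proof.
elim: n => [|n IHn].
  rewrite (_ : V 0 = setT); first exact: indep_future_setT.
  by apply/seteqP; split => w //= _; rewrite /at_v1/= (walk_start walk).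
apply: (indep_future_step (D := ~` V n) (K := jump_rate k0)).
- exact/measurableC/measurable_at_v1.
- exact: measurable_at_v1.
- by apply: indep_future_setC => //; [exact: measurable_at_v1|exact: indep_future_setT].
- exact: measurable_jump_rate.
- exact: jump_rate_ge0.
- move=> A s B mA mB.
  have hA : history tau X n (S n.+1 @^-1` A `&` cylinder tau s B).
    by apply: historyI; [exact: history_move_time|exact: history_cylinder].
  rewrite -[in LHS]setIA [in LHS]setIC (walk_jump_v1 k02 walk hA).
  by congr (integral _ _ _); rewrite setIC [in RHS]setIAC -setIA.
Qed.

Lemma indep_future_not_at_v1 n : indep_future tau n (~` V n).
Proof.
apply: indep_future_setC; first exact: measurable_at_v1.
  exact: indep_future_setT.
exact: indep_future_at_v1.
Qed.

Definition sojourn (n : nat) (t : R) : set Omega :=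
  [set w | (S n w <= t < S n.+1 w)%R].

Lemma sojournE n t : sojourn n t = [set w | (S n w <= t < S n w + tau n w)%R].
Proof. by apply/seteqP; split => w; rewrite /sojourn/= move_timeS. Qed.

Lemma measurable_sojourn_set n t : measurable (sojourn n t).
Proof. by rewrite sojournE; apply: measurable_sojourn; exact: measurable_move_time. Qed.

Lemma integral_at_v1S n (phi : R -> \bar R) :
  measurable_fun setT phi -> (forall t, 0 <= phi t) ->
  \int[P]_(w in V n.+1) phi (S n.+1 w) =
  \int[P]_(w in ~` V n) ((jump_rate k0 (S n.+1 w))%:E * phi (S n.+1 w)).
Proof.
move=> mphi phi0; under [LHS]eq_integral do rewrite -[phi _]mul1e.
have mS := measurable_move_time tau n.+1.
apply: (@ge0_integral_transfer _ _ _ _ _ _ R P P (V n.+1) (~` V n)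
  (S n.+1) (S n.+1) (cst 1%R) (jump_rate k0 \o S n.+1) phi) => //.
- exact: measurable_at_v1.
- exact/measurableC/measurable_at_v1.
- apply: measurable_funTS; apply: measurableT_comp => //.
  exact: measurable_jump_rate.
- by move=> w _; exact: jump_rate_ge0.
- move=> A mA.
  rewrite (integral_cst P
    (measurableI _ _ (measurable_at_v1 X n.+1) (measurable_preimageT mS mA)) 1).
  rewrite mul1e setIC [in RHS]setIC.
  apply: (walk_jump_v1 k02 walk); exact: history_move_time.
Qed.

Lemma integral_move_timeS n D (phi : R -> \bar R) :
  measurable D -> indep_future tau n D ->
  measurable_fun setT phi -> (forall t, 0 <= phi t) ->
  \int[P]_(w in D) phi (S n.+1 w) =
  \int[mu]_t (lambda%:E * (phi t * P (D `&` sojourn n t))).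
Proof.
move=> mD iD mphi phi0.
under eq_integral do rewrite move_timeS.
rewrite (compensator lambda0 (@walk_exponential _ _ _ _ _ _ _ _ walk n) mD
  (measurable_move_time tau n))//.
  by under eq_integral do rewrite -sojournE.
exact: indep_future_indep.
Qed.

Lemma probability_sojournI n D t : measurable D -> indep_future tau n D ->
  P (D `&` sojourn n t) = \int[P]_(w in D) (survival lambda t (S n w))%:E.
Proof.
move=> mD iD; rewrite sojournE.
apply: (probability_sojourn (@walk_exponential _ _ _ _ _ _ _ _ walk n) mD
  (measurable_move_time tau n)).
exact: indep_future_indep.
Qed.

Let msurv t : measurable_fun setT (survival lambda t).
Proof.
apply: (measurableT_comp (f := fun z => survival lambda z.1 z.2) (g := pair t)).
  exact: measurable_survival.
exact: pair1_measurable.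
Qed.

Lemma sojourn_at_v1_0 t : P (V 0 `&` sojourn 0 t) = (survival lambda t 0)%:E.
Proof.
rewrite probability_sojournI; [|exact: measurable_at_v1|exact: indep_future_at_v1].
rewrite (_ : V 0 = setT); last first.
  by apply/seteqP; split => w //= _; rewrite /at_v1/= (walk_start walk).
under eq_integral do rewrite move_time0.
apply: (etrans (integral_cst P measurableT (survival lambda t 0)%:E)).
by rewrite -[RHS]mule1; congr (_ * _); exact: probability_setT.
Qed.

(** Decomposition by the time [s] of the arrival at v_1: the walker is elsewhere until [s], jumps to
    v_1, and then stays until after [t]. *)
Lemma sojourn_at_v1S n t : P (V n.+1 `&` sojourn n.+1 t) =
  \int[mu]_s (lambda%:E *
    ((jump_rate k0 s * survival lambda t s)%:E * P (~` V n `&` sojourn n s))).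
Proof.
rewrite probability_sojournI; [|exact: measurable_at_v1|exact: indep_future_at_v1].
rewrite (integral_at_v1S n (phi := EFin \o survival lambda t)); last 2 first.
- exact/measurable_EFinP.
- by move=> s; rewrite lee_fin survival_ge0.
under eq_integral do rewrite /= -EFinM.
rewrite (integral_move_timeS
  (phi := fun s => (jump_rate k0 s * survival lambda t s)%:E))//.
- exact/measurableC/measurable_at_v1.
- exact: indep_future_not_at_v1.
- by apply/measurable_EFinP/measurable_funM => //; exact: measurable_jump_rate.
- by move=> s; rewrite lee_fin mulr_ge0 ?survival_ge0 ?jump_rate_ge0.
Qed.

Lemma visit_at_v1S n t : P (V n.+1 `&` [set w | (S n.+1 w <= t)%R]) =
  \int[mu]_(s in `]-oo, t])
    (lambda%:E * ((jump_rate k0 s)%:E * P (~` V n `&` sojourn n s))).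
Proof.
have mt : measurable (`]-oo, t]%classic : set R) by [].
pose f : R -> R := \1_(`]-oo, t]%classic : set R).
have mi : measurable_fun setT (EFin \o f).
  exact/measurable_EFinP/measurable_indic.
have mSt : measurable [set w | (S n.+1 w <= t)%R].
  exact: (measurable_preimageT (measurable_move_time tau n.+1) mt).
transitivity (\int[P]_(w in V n.+1) (EFin \o f) (S n.+1 w)).
  by rewrite setIC -integral_indic//; exact: measurable_at_v1.
rewrite integral_at_v1S//; last by move=> s; rewrite lee_fin.
under eq_integral do rewrite -EFinM.
rewrite (integral_move_timeS (phi := fun s => (jump_rate k0 s * f s)%:E)).
- rewrite [RHS]integral_mkcond; apply: eq_integral => s _.
  rewrite patchE /f indicE; case: ifP; first by rewrite mulr1.
  by rewrite mulr0 mul0e mule0.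
- exact/measurableC/measurable_at_v1.
- exact: indep_future_not_at_v1.
- apply/measurable_EFinP/measurable_funM; first exact: measurable_jump_rate.
  exact: measurable_indic.
- by move=> s; rewrite lee_fin mulr_ge0 ?jump_rate_ge0.
Qed.

Lemma move_timeS_le n t : P [set w | (S n.+1 w <= t)%R] =
  \int[mu]_(s in `]-oo, t]) (lambda%:E * P (sojourn n s)).
Proof.
have mt : measurable (`]-oo, t]%classic : set R) by [].
pose f : R -> R := \1_(`]-oo, t]%classic : set R).
have mi : measurable_fun setT (EFin \o f).
  exact/measurable_EFinP/measurable_indic.
have mSt : measurable [set w | (S n.+1 w <= t)%R].
  exact: (measurable_preimageT (measurable_move_time tau n.+1) mt).
transitivity (\int[P]_w (EFin \o f) (S n.+1 w)).
  by rewrite -[X in P X]setIT -integral_indic.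
rewrite (integral_move_timeS _ (@indep_future_setT n))//; last by move=> s; rewrite lee_fin.
rewrite [RHS]integral_mkcond; apply: eq_integral => s _.
rewrite setTI patchE /= /f indicE; case: ifP; first by rewrite mul1e.
by rewrite mul0e mule0.
Qed.

(** By [probability_sojournI] this is a partial integral of a jointly measurable function, hence
    measurable by Tonelli. *)
Lemma measurable_sojourn_time n D : measurable D -> indep_future tau n D ->
  measurable_fun setT (fun t => P (D `&` sojourn n t)).
Proof.
move=> mD iD.
pose F (z : Omega * R) : \bar R := (survival lambda z.2 (S n z.1))%:E.
have mF : measurable_fun setT F.
  apply/measurable_EFinP.
  apply: (measurableT_comp (f := fun z => survival lambda z.1 z.2)
    (g := fun w => (w.2, S n w.1))); first exact: measurable_survival.
  apply: measurable_fun_pair => //; apply: measurableT_comp => //.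
  exact: measurable_move_time.
rewrite (_ : (fun _ => _) = fubini_G (mrestr P mD) F).
  apply: (measurable_fun_fubini_tonelli_G (m1 := mrestr P mD)) => //.
  by move=> z; rewrite lee_fin survival_ge0.
apply/funext => t; rewrite probability_sojournI// /fubini_G /F /= ge0_integral_mrestr//.
  apply/measurable_EFinP/measurableT_comp => //; exact: measurable_move_time.
by move=> w; rewrite lee_fin survival_ge0.
Qed.

End recursion.

(** * Summation over the moves and non-explosion *)

Section sums.
Context d (Omega : measurableType d) (R : realType) (P : probability Omega R).
Variables (k0 : nat) (lambda : R).
Variables (tau : nat -> {RV P >-> R}) (X : nat -> {RV P >-> nat}).
Hypothesis lambda0 : 0 < lambda.
Hypothesis walk : growing_complete_walk k0 lambda tau X.
Local Open Scope ereal_scope.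
Notation mu := (@lebesgue_measure R).
Notation S := (move_time tau).
Notation V := (at_v1 X).

(* Waiting times are nonnegative only almost surely, so the sojourn sets need not
   be disjoint. *)
Lemma sum_sojourn (D : nat -> set Omega) t : (forall n, measurable (D n)) ->
  \sum_(n <oo) P (D n `&` sojourn tau n t) =
  P (\bigcup_n (D n `&` sojourn tau n t)).
Proof.
move=> mD.
(* On [G], of full probability, the move times are ordered and the sojourns become disjoint. *)
pose G := \bigcap_k (tau k @^-1` `[0%R, +oo[%classic).
have mG : measurable G.
  apply: bigcapT_measurable => k.
  by apply: measurable_preimageT => //; exact: measurable_funPT.
have PG E : measurable E -> P (E `&` G) = P E.
  move=> mE; have PNG : P (E `\` G) = 0.
    apply: (@subset_measure0 _ _ _ P _ (~` G)).
    - exact: measurableD.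
    - exact: measurableC.
    - exact: subDsetr.
    - have mCG := measurableC mG.
      apply/(negligibleP P mCG); apply: negligibleS (ae_tau_ge0 walk).
      by move=> w NG /= tau0; apply: NG => k _ /=; rewrite in_itv/= andbT.
  rewrite -[in RHS](setUIDK E G); apply/esym/measureU0 => //.
  - exact: measurableI.
  - exact: measurableD.
have mDT n : measurable (D n `&` sojourn tau n t).
  by apply: measurableI => //; exact: measurable_sojourn_set.
rewrite -(PG _ (bigcupT_measurable _ mDT)) setI_bigcupl measure_bigcup//.
- transitivity (\sum_(n <oo) P (D n `&` sojourn tau n t `&` G)).
    by apply: eq_eseriesr => n _; rewrite PG.
  by apply: eq_eseriesl => n; rewrite in_setT.
- by move=> n _; exact: measurableI.
- apply/trivIsetP => m n _ _.
  wlog mn : m n / (m < n)%N.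
    move=> H; rewrite neq_ltn => /orP[|] mn.
      by apply: H => //; rewrite neq_ltn mn.
    by rewrite setIC; apply: H => //; rewrite neq_ltn mn.
  move=> _; apply/seteqP; split => // w [[[_ /andP[_ Sm]] Gw] [[_ /andP[Sn _]] _]].
  have tau0 k : (0 <= tau k w)%R by have := Gw k I; rewrite /= in_itv/= andbT.
  have := lt_le_trans Sm (move_time_nondecreasing tau0 mn).
  by rewrite ltNge Sn.
Qed.

Definition reached t : set Omega := \bigcup_n sojourn tau n t.

Lemma sum_sojournT t : \sum_(n <oo) P (sojourn tau n t) = P (reached t).
Proof.
by have := sum_sojourn t (fun=> measurableT); under eq_eseriesr do rewrite setTI;
  under eq_bigcupr do rewrite setTI.
Qed.

Lemma sojourn_lt0 n D t : (t < 0)%R -> measurable D -> P (D `&` sojourn tau n t) = 0.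
Proof.
move=> t0 mD.
have mDT : measurable (D `&` sojourn tau n t).
  by apply: measurableI => //; exact: measurable_sojourn_set.
apply/(negligibleP P mDT); apply: negligibleS (ae_tau_ge0 walk).
move=> w [_ /andP[Snt _]] /= tau0.
by have := le_lt_trans (le_trans (move_time_ge0 n tau0) Snt) t0; rewrite ltxx.
Qed.

(** The densities of the move times sum to [lambda * P (reached s)]. Bounding this probability by 1
    is enough, so that [probability_reached] can be deduced without circularity. *)
Lemma sum_move_timeS_le t : (0 <= t)%R ->
  \sum_(n <oo) P [set w | (S n.+1 w <= t)%R] <= (lambda * t)%:E.
Proof.
move=> t0.
have msoj n : measurable_fun setT (fun s => P (sojourn tau n s)).
  have := measurable_sojourn_time lambda0 walk measurableT
    (@indep_future_setT _ _ _ _ _ _ _ _ walk n).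
  by under eq_fun do rewrite setTI.
have l0 : 0 <= lambda%:E by rewrite lee_fin ltW.
under eq_eseriesr do rewrite (move_timeS_le lambda0 walk).
rewrite -integral_nneseries//; last 2 first.
- by move=> n; apply: measurable_funeM; apply: measurable_funTS; exact: msoj.
- by move=> n s _; rewrite mule_ge0.
rewrite [leLHS](_ : _ = \int[mu]_(s in `[0%R, t]) (lambda%:E * P (reached s))); last first.
  rewrite set_itv0c_setI integral_mkcondr; apply: eq_integral => s _.
  rewrite nneseriesZl// sum_sojournT patchE; case: ifPn => //.
  rewrite notin_setE /= in_itv/= andbT => /negP; rewrite -ltNge => s0.
  rewrite -sum_sojournT eseries0 ?mule0// => n _ _.
  by rewrite -[sojourn _ _ _]setTI sojourn_lt0.
apply: (@le_trans _ _ (\int[mu]_(s in `[0%R, t]) lambda%:E)).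
  apply: ge0_le_integral => //.
  - by move=> s _; apply: mule_ge0 => //; exact: measure_ge0.
  - apply: measurable_funeM; apply: measurable_funTS.
    rewrite (_ : (fun _ => _) = fun s => \sum_(n <oo) P (sojourn tau n s)); last first.
      by apply/funext => s; rewrite sum_sojournT.
    by apply: ge0_emeasurable_sum => // n _; exact: msoj.
  - move=> s _; rewrite -[leRHS]mule1; apply: lee_wpmul2l => //.
    apply: probability_le1; apply: bigcupT_measurable => n.
    exact: measurable_sojourn_set.
rewrite integral_cst//= lebesgue_measure_itv/= lte_fin.
by case: ltP => [|_]; rewrite ?sube0 ?mule0// lee_fin mulr_ge0// ltW.
Qed.

(* If t is not reached, infinitely many moves occur before t, whose expected number
   is at most lambda t. *)
Lemma probability_reached t : (0 <= t)%R -> P (reached t) = 1.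
Proof.
move=> t0.
have mR : measurable (reached t).
  by apply: bigcupT_measurable => n; exact: measurable_sojourn_set.
have mS n : measurable [set w | (S n.+1 w <= t)%R].
  have mt : measurable (`]-oo, t]%classic : set R) by [].
  exact: (measurable_preimageT (measurable_move_time tau n.+1) mt).
(* If [S m <= t < S m.+1], then [t] would be reached; so [S m <= t] propagates from [S 0 = 0]. *)
have sub n : ~` reached t `<=` [set w | (S n.+1 w <= t)%R].
  move=> w NR /=; elim: n.+1 => [|m IHm]; first by rewrite move_time0.
  by rewrite leNgt; apply/negP => tS; apply: NR; exists m => //; apply/andP.
have mCR := measurableC mR.
suff PC0 : P (~` reached t) = 0.
  by have := probability_setC P mCR; rewrite setCK PC0 sube0.
pose c := fine (P (~` reached t)).
have cE : P (~` reached t) = c%:E by rewrite fineK// fin_num_measure.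
have c0 : (0 <= c)%R by rewrite fine_ge0.
rewrite cE; apply/eqP; rewrite eqe -[_ == _]negbK; apply/negP => cn0.
have cgt0 : (0 < c)%R by rewrite lt_neqAle eq_sym cn0.
(* Chosen so that [c * N > lambda * t], whereas each of the first [N] terms of the sum is at least
   [c]. *)
pose N := (Num.truncn (lambda * t / c)).+1.
have : (c *+ N)%:E <= (lambda * t)%:E.
  apply: le_trans (sum_move_timeS_le t0).
  apply: (@le_trans _ _ (\sum_(0 <= n < N) P [set w | (S n.+1 w <= t)%R])).
    rewrite -[X in (_ *+ X)%R]subn0 -sumr_const_nat -sumEFin; apply: lee_sum => n _.
    by rewrite -cE; apply: le_measure; rewrite ?inE.
  exact: nneseries_lim_ge.
rewrite lee_fin -mulr_natr -ler_pdivlMl// mulrC leNgt.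
by rewrite /N truncnS_gt.
Qed.

Lemma sum_sojourn_complement t : (0 <= t)%R ->
  \sum_(n <oo) P (V n `&` sojourn tau n t) +
  \sum_(n <oo) P (~` V n `&` sojourn tau n t) = 1.
Proof.
move=> t0; rewrite -nneseriesD// -[RHS](probability_reached t0) -sum_sojournT.
apply: eq_eseriesr => n _.
have mT := measurable_sojourn_set tau n t.
have mV := measurable_at_v1 X n.
rewrite -measureU; [|exact: measurableI|exact/measurableI/mT/measurableC|].
  by rewrite -setIUl setUv setTI.
by rewrite setIACA setICr set0I.
Qed.

Lemma at_time_v1E t : at_time tau X t 1%N = \bigcup_n (V n `&` sojourn tau n t).
Proof.
apply/seteqP; split => w.
  by move=> [n [St Xw]]; exists n.
by move=> [n _ [Xw St]]; exists n.
Qed.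

Lemma expected_visitsE t : expected_visits tau X 1%N t =
  \sum_(n <oo) P (V n.+1 `&` [set w | (S n.+1 w <= t)%R]).
Proof.
pose E n := [set w | [/\ (0 < n)%N, (S n w <= t)%R & X n w = 1%N]].
have mE n : measurable (E n).
  have mt : measurable (`]-oo, t]%classic : set R) by [].
  case: n => [|n].
    by rewrite (_ : E 0%N = set0)//; apply/seteqP; split => // w [].
  rewrite (_ : E n.+1 = V n.+1 `&` S n.+1 @^-1` `]-oo, t]%classic).
    apply: measurableI; first exact: measurable_at_v1.
    by apply: measurable_preimageT => //; exact: measurable_move_time.
  by apply/seteqP; split => w /=; rewrite in_itv/=; [move=> []|move=> []].
rewrite /expected_visits /visits.
transitivity (\int[P]_w \sum_(n <oo) (\1_(E n) w)%:E).
  apply: eq_integral => w _; rewrite counting_dirac; apply: eq_eseriesr => n _.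
  by rewrite /dirac !indicE; congr (_%:R%:E); congr nat_of_bool;
    apply/idP/idP; rewrite !inE.
rewrite integral_nneseries//; last first.
  by move=> n; apply/measurable_EFinP; exact: measurable_indic.
transitivity (\sum_(n <oo) P (E n)).
  by apply: eq_eseriesr => n _; rewrite integral_indic// setIT.
(* Index 0 contributes nothing, as the initial presence is not a visit. *)
rewrite nneseries_recl// [X in P X + _](_ : _ = set0); last first.
  by apply/seteqP; split => // w [].
rewrite measure0 add0e -nneseries_addn//; apply: eq_eseriesr => n _.
rewrite addn1; congr (P _).
by apply/seteqP; split => w /=; [move=> []|move=> []].
Qed.

End sums.

(** * Explicit integration *)

Section ode.
Variable R : realType.

Lemma is_derive_expR_affine (b c x : R) :
  is_derive x 1 (fun u : R => expR (b * (u - c))) (b * expR (b * (x - c))).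
Proof.
have h : is_derive x 1 (fun u : R => b * (u - c)) b.
  apply: is_derive_eq; rewrite /GRing.scale/=; ring.
have := is_derive1_comp (f := expR) (g := fun u : R => b * (u - c)) (x := x) _ h.
by move=> /(_ _ (is_derive_expR _)); rewrite mulrC.
Qed.

Lemma continuous_expR_affine (b c : R) : continuous (fun u : R => expR (b * (u - c))).
Proof.
move=> x; apply: differentiable_continuous; apply/derivable1_diffP.
by have [] := is_derive_expR_affine b c x.
Qed.

(** Continuity on the closed interval and a derivative inside it are the right assumptions here: at
    integer times the equation changes its coefficients. *)
Lemma affine_ode_solution (y : R -> R) (a b alpha beta : R) : beta != 0 ->
  {within `[a, b], continuous y} ->
  (forall x, x \in `]a, b[ -> is_derive x 1 y (alpha - beta * y x)) ->
  forall t, t \in `[a, b] ->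
  y t = alpha / beta + (y a - alpha / beta) * expR (- beta * (t - a)).
Proof.
move=> beta0 cy dy t; rewrite in_itv/= => /andP[lat ltb].
(* Deviation from the equilibrium [alpha / beta], times the integrating factor; it is constant. *)
pose W x := (y x - alpha / beta) * expR (beta * (x - a)).
have dW x : x \in `]a, t[ -> is_derive x 1 W 0.
  rewrite in_itv/= => /andP[ax xt].
  have hy : is_derive x 1 y (alpha - beta * y x).
    by apply: dy; rewrite in_itv/= ax (lt_le_trans xt).
  have he := is_derive_expR_affine beta a x.
  have hyc : is_derive x 1 (fun x => y x - alpha / beta) (alpha - beta * y x).
    by apply: is_derive_eq; rewrite subr0.
  have := is_deriveM hyc he.
  move=> h; apply: (is_derive_eq h); rewrite /GRing.scale/=; field.
  exact: beta0.
have cW : {within `[a, t], continuous W}.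
  have cyt : {within `[a, t], continuous y}.
    apply: continuous_subspaceW cy => x /=; rewrite !in_itv/= => /andP[-> xt] /=.
    exact: le_trans ltb.
  have ce : {within `[a, t], continuous (fun u : R => expR (beta * (u - a)))}.
    by apply: continuous_subspaceT; exact: continuous_expR_affine.
  move=> x; apply: cvgM; last exact: ce.
  by apply: cvgB; [exact: cyt|exact: cvg_cst].
have [c _] := MVT_segment lat dW cW.
rewrite mul0r => /eqP; rewrite subr_eq0 /W subrr mulr0 expR0 mulr1 => /eqP Wt.
by rewrite -Wt -mulrA -expRD mulNr subrr expR0 mulr1 addrC subrK.
Qed.

(** The integrand is [g] times one minus the solution with equilibrium [p] and value [q] at [a]. *)
Lemma integral_relaxation (g p q beta a b : R) : beta != 0 -> a < b ->
  (\int[lebesgue_measure]_(s in `[a, b])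
     (g * (1 - (p + (q - p) * expR (- beta * (s - a)))))%:E)%E =
  (g * (1 - p) * (b - a) + g * (p - q) / beta * (1 - expR (- beta * (b - a))))%:E.
Proof.
move=> beta0 ab.
pose F s := g * ((1 - p) * (s - a) + (q - p) / beta * expR (- beta * (s - a))).
have dF (x : R) : is_derive x 1 F (g * (1 - (p + (q - p) * expR (- beta * (x - a))))).
  have he := is_derive_expR_affine (- beta) a x.
  apply: is_derive_eq; rewrite /GRing.scale/=; field.
  exact: beta0.
have cF : continuous F.
  move=> x; apply: differentiable_continuous; apply/derivable1_diffP.
  by have [] := dF x.
rewrite (@continuous_FTC2 _ _ F)//.
- rewrite -EFinB; congr EFin; rewrite /F subrr mulr0 mulr0 expR0; field.
  exact: beta0.
- apply: continuous_subspaceT => x.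
  apply: cvgM; first exact: cvg_cst.
  apply: cvgB; first exact: cvg_cst.
  apply: cvgD; first exact: cvg_cst.
  apply: cvgM; first exact: cvg_cst.
  exact: continuous_expR_affine.
- split.
  + by move=> x _; have [] := dF x.
  + by apply: cvg_at_right_filter; exact: cF.
  + by apply: cvg_at_left_filter; exact: cF.
- by move=> x _; rewrite derive1E; have [_ ->] := dF x.
Qed.
End ode.

(** * The probability of being at v_1 and the expected number of visits *)

Section final.
Context d (Omega : measurableType d) (R : realType) (P : probability Omega R).
Variables (k0 : nat) (lambda : R).
Variables (tau : nat -> {RV P >-> R}) (X : nat -> {RV P >-> nat}).
Hypothesis k02 : (2 <= k0)%N.
Hypothesis lambda0 : 0 < lambda.
Hypothesis walk : growing_complete_walk k0 lambda tau X.
Notation mu := (@lebesgue_measure R).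
Notation S := (move_time tau).
Notation V := (at_v1 X).

Definition prob_v1 (t : R) : R := fine (P (at_time tau X t 1%N)).

(** For negative [t] this series is 0 rather than [1 - prob_v1 t], which cuts the integrals over the
    line down to nonnegative times. *)
Let pnot (t : R) : \bar R := (\sum_(n <oo) P (~` V n `&` sojourn tau n t))%E.

Let prob_v1E t : (\sum_(n <oo) P (V n `&` sojourn tau n t))%E = (prob_v1 t)%:E.
Proof.
rewrite (sum_sojourn walk t (measurable_at_v1 X)) -at_time_v1E fineK// fin_num_measure//.
rewrite at_time_v1E; apply: bigcupT_measurable => n.
by apply: measurableI; [exact: measurable_at_v1|exact: measurable_sojourn_set].
Qed.

Let pnotE t : 0 <= t -> pnot t = (1 - prob_v1 t)%:E.
Proof.
move=> t0; have := sum_sojourn_complement lambda0 walk t0.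
rewrite prob_v1E -/(pnot t); case: (pnot t) => // r.
by rewrite -EFinD => -[<-]; congr EFin; rewrite addrC addKr.
Qed.

Let prob_v1_le1 t : 0 <= t -> prob_v1 t <= 1.
Proof.
by move=> t0; rewrite -subr_ge0 -lee_fin -pnotE//; exact: nneseries_ge0.
Qed.

Let pnot_lt0 t : t < 0 -> pnot t = 0%E.
Proof.
move=> t0; rewrite /pnot eseries0// => n _ _.
by rewrite (sojourn_lt0 walk)//; exact/measurableC/measurable_at_v1.
Qed.

Let mpnotn n : measurable_fun setT (fun t => P (~` V n `&` sojourn tau n t)).
Proof.
apply: (measurable_sojourn_time lambda0 walk); first exact/measurableC/measurable_at_v1.
exact: (indep_future_not_at_v1 k02 walk).
Qed.

Lemma measurable_prob_v1 : measurable_fun setT prob_v1.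
Proof.
apply/measurable_EFinP.
rewrite (_ : EFin \o _ = fun t => (\sum_(n <oo) P (V n `&` sojourn tau n t))%E); last first.
  by apply/funext => t; rewrite prob_v1E.
apply: ge0_emeasurable_sum => // n _.
apply: (measurable_sojourn_time lambda0 walk); first exact: measurable_at_v1.
exact: (indep_future_at_v1 k02 walk).
Qed.

Definition v1_flux (s : R) : R := lambda * jump_rate k0 s * (1 - prob_v1 s).

Lemma v1_flux_ge0 s : 0 <= s -> 0 <= v1_flux s.
Proof.
by move=> s0; rewrite !mulr_ge0 ?jump_rate_ge0 ?subr_ge0 ?prob_v1_le1// ltW.
Qed.

Lemma measurable_v1_flux : measurable_fun setT v1_flux.
Proof.
apply: measurable_funM.
  by apply: measurable_funM => //; exact: measurable_jump_rate.
by apply: measurable_funB => //; exact: measurable_prob_v1.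
Qed.

Lemma expected_visits_flux (t : R) :
  expected_visits tau X 1%N t = (\int[mu]_(s in `[0%R, t]) (v1_flux s)%:E)%E.
Proof.
rewrite expected_visitsE.
under eq_eseriesr do rewrite (visit_at_v1S k02 lambda0 walk).
rewrite -integral_nneseries//; last 2 first.
- move=> n; apply: measurable_funeM; apply: emeasurable_funM.
    by apply/measurable_EFinP/measurable_funTS; exact: measurable_jump_rate.
  by apply: measurable_funTS; exact: mpnotn.
- by move=> n s _; rewrite !mule_ge0 ?lee_fin ?jump_rate_ge0// ltW.
rewrite set_itv0c_setI integral_mkcondr; apply: eq_integral => s _.
rewrite nneseriesZl; last by move=> n _; rewrite mule_ge0// lee_fin jump_rate_ge0.
rewrite nneseriesZl// -/(pnot s) patchE; case: ifPn => [|sN].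
  by rewrite inE/= in_itv/= andbT => s0; rewrite pnotE// muleA.
rewrite pnot_lt0 ?mule0//; move: sN.
by rewrite notin_setE /= in_itv/= andbT => /negP; rewrite -ltNge.
Qed.

(** The term 1 comes from the initial stay at v_1, the integral from later arrivals. The factor
    [expR (lambda * t)] frees the integrand of [t], which then enters only as upper bound. *)
Lemma prob_v1_renewal t : 0 <= t ->
  ((expR (lambda * t) * prob_v1 t)%:E =
   1 + \int[mu]_(s in `[0%R, t]) (expR (lambda * s) * v1_flux s)%:E)%E.
Proof.
move=> t0.
have ml : measurable_fun setT (fun s : R => expR (lambda * s)).
  by apply: measurableT_comp => //; exact: measurable_funM.
suff : ((prob_v1 t)%:E = (expR (- lambda * t))%:E +
   (expR (- lambda * t))%:E *
   \int[mu]_(s in `[0%R, t]) (expR (lambda * s) * v1_flux s)%:E)%E.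
  move=> e; rewrite EFinM e muleDr//.
  by rewrite muleA -!EFinM -expRD mulNr subrr expR0 mul1e.
rewrite -prob_v1E nneseries_recl// (sojourn_at_v1_0 k02 walk).
rewrite {1}/survival t0 subr0; congr (_ + _)%E.
rewrite -nneseries_addn//.
under eq_eseriesr do rewrite addn1 (sojourn_at_v1S k02 lambda0 walk).
rewrite -integral_nneseries//; last 2 first.
- move=> n; apply: measurable_funeM; apply: emeasurable_funM; last exact: mpnotn.
  apply/measurable_EFinP/measurable_funM; first exact: measurable_jump_rate.
  apply: (measurableT_comp (f := fun z => survival lambda z.1 z.2) (g := pair t)).
    exact: measurable_survival.
  exact: pair1_measurable.
- move=> n s _; rewrite !mule_ge0 ?lee_fin ?mulr_ge0 ?survival_ge0 ?jump_rate_ge0//.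
  exact: ltW.
rewrite -ge0_integralZl//; last 2 first.
- apply/measurable_EFinP/measurable_funTS/measurable_funM => //.
  exact: measurable_v1_flux.
- move=> s; rewrite /= in_itv/= => /andP[s0 _].
  by rewrite lee_fin mulr_ge0 ?expR_ge0 ?v1_flux_ge0.
rewrite [RHS]integral_mkcond; apply: eq_integral => s _.
rewrite nneseriesZl; last first.
  by move=> n _; rewrite mule_ge0// lee_fin mulr_ge0 ?survival_ge0 ?jump_rate_ge0.
rewrite nneseriesZl// -/(pnot s) patchE; case: ifPn => [|sN].
  rewrite inE/= in_itv/= => /andP[s0 st].
  rewrite pnotE// /survival st -!EFinM; congr EFin.
  rewrite /v1_flux (_ : - lambda * (t - s) = - lambda * t + lambda * s) ?expRD; ring.
have [s0|s0] := ltP s 0; first by rewrite pnot_lt0// !mule0.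
rewrite /survival ifF ?mulr0 ?mul0e ?mule0//; apply/negP => st.
by move: sN; rewrite notin_setE /= in_itv/= s0 st.
Qed.

Definition v1_mass (t : R) : R :=
  \int[mu]_(s in `[0, t]) (expR (lambda * s) * v1_flux s).

(** Finiteness is read off the renewal equation, whose left-hand side is a real number. *)
Lemma integrable_v1_flux (t : R) : 0 <= t ->
  mu.-integrable `[0, t] (EFin \o (fun s : R => expR (lambda * s) * v1_flux s)).
Proof.
move=> t0; apply/integrableP; split.
  apply/measurable_EFinP/measurable_funTS/measurable_funM.
    by apply: measurableT_comp => //; exact: measurable_funM.
  exact: measurable_v1_flux.
under eq_integral => s.
  rewrite inE/= in_itv/= => /andP[s0 _].
  rewrite /= ger0_norm; last by rewrite mulr_ge0 ?expR_ge0 ?v1_flux_ge0.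
  over.
have := prob_v1_renewal t0; rewrite /=.
by case: (integral _ _ _) => //= r; rewrite ltry.
Qed.

Lemma prob_v1_mass t : 0 <= t -> prob_v1 t = expR (- lambda * t) * (1 + v1_mass t).
Proof.
move=> t0; have := prob_v1_renewal t0.
rewrite -[X in (_ = 1 + X)%E]fineK; last exact: integrable_fin_num (integrable_v1_flux t0).
rewrite -EFinD => -[]; rewrite -/(v1_mass t) => <-.
by rewrite mulrA -expRD mulNr addrC subrr expR0 mul1r.
Qed.

(* The shift by 0 puts the exponential in the shape of is_derive_expR_affine. *)
Let y (t : R) : R := expR (- lambda * (t - 0)) * (1 + v1_mass t).

Let yE t : 0 <= t -> prob_v1 t = y t.
Proof. by move=> t0; rewrite prob_v1_mass// /y subr0. Qed.

Let y_continuous (b : R) : 0 <= b -> {within `[0, b], continuous y}.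
Proof.
move=> b0.
have cm := parameterized_integral_continuous b0 (integrable_v1_flux b0).
have ce : {within `[0, b], continuous (fun u : R => expR (- lambda * (u - 0)))}.
  by apply: continuous_subspaceT; exact: continuous_expR_affine.
move=> x; apply: cvgM; first exact: ce.
by apply: cvgD; [exact: cvg_cst|exact: cm].
Qed.

Lemma prob_v1_0 : prob_v1 0 = 1.
Proof.
rewrite prob_v1_mass// mulr0 expR0 mul1r.
by rewrite /v1_mass set_itv1 Rintegral_set1 addr0.
Qed.

Section interval.
Variable i : nat.
Let K : R := (k0 + i)%:R.

Let K_ge2 : 2 <= K.
Proof. by rewrite ler_nat ltn_addr. Qed.

Let K_neq0 : K != 0.
Proof. by apply: lt0r_neq0; apply: lt_le_trans K_ge2. Qed.

Let K1_neq0 : K - 1 != 0.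
Proof.
apply: lt0r_neq0; rewrite subr_gt0; apply: lt_le_trans K_ge2.
by rewrite ltr1n.
Qed.

Let rateE (s : R) : i%:R <= s < i.+1%:R -> jump_rate k0 s = (K - 1)^-1.
Proof.
move=> si; rewrite /jump_rate (truncn_def si) /K -subn1 natrB//.
by rewrite addn_gt0 (ltnW k02).
Qed.

(** Sum of the rate [lambda] of leaving v_1 and the rate [lambda / (K - 1)] of returning, where [K]
    is the number of vertices on this interval. *)
Let beta := lambda * (K / (K - 1)).

Let beta_neq0 : beta != 0.
Proof. by rewrite !mulf_neq0 ?invr_neq0// gt_eqF. Qed.

Let i_ge0 : 0 <= i%:R :> R.
Proof. exact: ler0n. Qed.

Let ltiS : i%:R < i.+1%:R :> R.
Proof. by rewrite ltr_nat. Qed.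

Let dy (x : R) : x \in `]i%:R, i.+1%:R[ ->
  is_derive x 1 y (lambda / (K - 1) - beta * y x).
Proof.
rewrite in_itv/= => /andP[ix xi].
have x0 : 0 < x by exact: le_lt_trans ix.
have cyx : {for x, continuous y}.
  apply: (@within_continuous_continuous _ _ _ 0 i.+1%:R); first exact: lt_trans xi.
  - by apply: y_continuous.
  - by rewrite in_itv/= x0.
pose c s := expR (lambda * s) * v1_flux s.
(* The same integrand with the jump rate frozen and [prob_v1] replaced by [y]: it is continuous at
   [x] and agrees with [c] near [x]. *)
pose c' s := expR (lambda * (s - 0)) * (lambda * (K - 1)^-1 * (1 - y s)).
have cc' s : i%:R < s < i.+1%:R -> c s = c' s.
  move=> /andP[is_ si]; rewrite /c /c' /v1_flux subr0 rateE ?ltW ?is_//.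
  by rewrite yE// (le_trans i_ge0)// ltW.
have cc : {for x, continuous c}.
  have cc'x : {for x, continuous c'}.
    apply: cvgM; first exact: continuous_expR_affine.
    by apply: cvgM; [exact: cvg_cst|apply: cvgB; [exact: cvg_cst|exact: cyx]].
  rewrite /prop_for /continuous_at cc' ?ix//.
  apply: cvg_trans cc'x; apply: near_eq_cvg.
  have xi' : x \in `]i%:R, i.+1%:R[ by rewrite in_itv/= ix.
  near=> s; apply/esym/cc'.
  have : s \in `]i%:R, i.+1%:R[ by near: s; exact: near_in_itvoo.
  by rewrite in_itv.
have [dM M'] := continuous_FTC1_closed xi
  (integrable_v1_flux (ler0n _ i.+1)) x0 cc.
have hM : is_derive x 1 v1_mass (c x).
  by split; [exact: dM|rewrite -derive1E; exact: M'].
have he := is_derive_expR_affine (- lambda) 0 x.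
have hM1 : is_derive x 1 (fun t => 1 + v1_mass t) (c x).
  by apply: (is_derive_eq (is_deriveD (is_derive_cst _ _ _) hM)); rewrite add0r.
have h := is_deriveM he hM1.
apply: (is_derive_eq h); rewrite /GRing.scale/= cc' ?ix// /c'.
have exx : expR (- lambda * (x - 0)) * expR (lambda * (x - 0)) = 1.
  by rewrite -expRD mulNr addNr expR0.
transitivity ((expR (- lambda * (x - 0)) * expR (lambda * (x - 0))) *
    (lambda / (K - 1) * (1 - y x)) + - lambda * y x).
  rewrite [in X in _ = _ + X]/y; ring.
rewrite exx mul1r.
by rewrite /beta; move: K1_neq0; generalize (y x) K => Y k ?; field.
Unshelve. all: by end_near. Qed.

Lemma prob_v1_itv (t : R) : i%:R <= t <= i.+1%:R ->
  prob_v1 t =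
  K^-1 + (prob_v1 i%:R - K^-1) * expR (- (lambda * (K / (K - 1))) * (t - i%:R)).
Proof.
move=> it; rewrite !yE//; last by case/andP: it => /(le_trans i_ge0).
have cy : {within `[i%:R, i.+1%:R], continuous y}.
  apply: continuous_subspaceW (y_continuous (ler0n _ i.+1)) => x /=.
  by rewrite !in_itv/= => /andP[/(le_trans i_ge0) -> ->].
(* The equilibrium is the uniform probability on [K] vertices. *)
have pE : K^-1 = lambda / (K - 1) / beta.
  have l0 : lambda != 0 by rewrite gt_eqF.
  rewrite /beta; move: K_neq0 K1_neq0; generalize K => k ? ?.
  by field; rewrite l0; apply/and3P.
rewrite pE; apply: (affine_ode_solution beta_neq0 cy dy).
by rewrite in_itv.
Qed.

Lemma prob_v1S : prob_v1 i.+1%:R =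
  K^-1 + (prob_v1 i%:R - K^-1) * expR (- lambda * (K / (K - 1))).
Proof.
rewrite prob_v1_itv; last by rewrite lexx ltW.
by rewrite -[in X in expR X]natrB// subSnn mulr1 mulNr.
Qed.

Lemma integral_v1_flux_itv :
  (\int[mu]_(s in `]i%:R, i.+1%:R]) (v1_flux s)%:E =
   (lambda / K + (1 - prob_v1 i%:R * K) / K ^+ 2 *
     (1 - expR (- lambda * (K / (K - 1)))))%:E)%E.
Proof.
(* The interval open on the left suits additivity; the one open on the right is where the jump rate
   is constant. They differ by null sets. *)
rewrite integral_itv_obnd_cbnd; last first.
  by apply/measurable_EFinP; apply: measurable_funTS; exact: measurable_v1_flux.
rewrite -integral_itv_bndo_bndc; last first.
  by apply/measurable_EFinP; apply: measurable_funTS; exact: measurable_v1_flux.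
pose f s := lambda / (K - 1) *
  (1 - (K^-1 + (prob_v1 i%:R - K^-1) * expR (- beta * (s - i%:R)))).
have mf : measurable_fun setT f.
  apply: continuous_measurable_fun => x.
  apply: cvgM; first exact: cvg_cst.
  apply: cvgB; first exact: cvg_cst.
  apply: cvgD; first exact: cvg_cst.
  apply: cvgM; [exact: cvg_cst|exact: continuous_expR_affine].
transitivity (\int[mu]_(s in `[i%:R, i.+1%:R[) (f s)%:E)%E.
  apply: eq_integral => s; rewrite inE/= in_itv/= => /andP[is_ si].
  by rewrite /v1_flux rateE ?is_// prob_v1_itv ?is_ ?ltW.
rewrite integral_itv_bndo_bndc; last first.
  by apply/measurable_EFinP; exact: measurable_funTS.
rewrite integral_relaxation//; congr EFin.
rewrite -natrB// subSnn !mulr1 -mulNr.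
have l0 : lambda != 0 by rewrite gt_eqF.
rewrite /beta; move: K_neq0 K1_neq0; generalize K => k ? ?.
by field; rewrite l0; apply/and3P.
Qed.

End interval.

Lemma expected_visits_sum (T : nat) :
  expected_visits tau X 1%N T%:R =
  (\sum_(0 <= i < T) (lambda / (k0 + i)%:R +
     (1 - prob_v1 i%:R * (k0 + i)%:R) / (k0 + i)%:R ^+ 2 *
     (1 - expR (- lambda * ((k0 + i)%:R / ((k0 + i)%:R - 1))))))%:E.
Proof.
rewrite expected_visits_flux.
elim: T => [|T IHT]; first by rewrite set_itv1 integral_set1 big_geq.
rewrite big_nat_recr//= EFinD -IHT -integral_v1_flux_itv.
have T0 : 0 <= T%:R :> R by exact: ler0n.
have TS : T%:R <= T.+1%:R :> R by rewrite ler_nat.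
rewrite -ge0_integral_setU//.
- congr (integral _ _ _); apply/seteqP; split => s /=; rewrite !in_itv/=.
    by move=> /andP[-> ->]; rewrite andbT; case: leP; [left|right].
  by move=> [/andP[-> /le_trans]|/andP[/ltW/(le_trans T0) -> ->]//]; exact.
- apply/measurable_EFinP/measurable_funTS; exact: measurable_v1_flux.
- move=> s /=; rewrite !in_itv/= => H; rewrite lee_fin v1_flux_ge0//.
  by case: H => /andP[// /ltW/(le_trans T0)].
- apply/disj_setPS => s /=; rewrite !in_itv/= => -[/andP[_ sT] /andP[Ts _]].
  by have := le_lt_trans sT Ts; rewrite ltxx.
Qed.

End final.

Theorem theorem3p1 (d : measure_display) (Omega : measurableType d)
    (R : realType) (P : probability Omega R) (k0 : nat) (lambda : R)
    (tau : nat -> {RV P >-> R}) (X : nat -> {RV P >-> nat})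
    (hk0 : (3 <= k0)%N) (hlambda : 0 < lambda)
    (hwalk : growing_complete_walk k0 lambda tau X)
    (T : nat) (hT : (1 <= T)%N) :
  let k : R := k0%:R in
  let Q (i : nat) : R := fine (P (at_time tau X i%:R 1%N)) in
  expected_visits tau X 1%N T%:R =
    (\sum_(0 <= i < T)
      (lambda / (k + i%:R) +
       (1 - Q i * (k + i%:R)) / (k + i%:R) ^+ 2 *
       (1 - expR (- lambda * ((k + i%:R) / (k + i%:R - 1))))))%:E
  /\
  forall i : nat,
    Q i =
    (\prod_(1 <= l < i.+1)
       expR (- lambda * ((k + l%:R - 1) / (k + l%:R - 2)))) *
    (1 + \sum_(1 <= j < i.+1)
       (1 - expR (- lambda * ((k + j%:R - 1) / (k + j%:R - 2)))) /
       ((k + j%:R - 1) *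
        \prod_(1 <= l < j.+1)
          expR (- lambda * ((k + l%:R - 1) / (k + l%:R - 2))))).
Proof.
move=> k Q.
have k02 : (2 <= k0)%N by exact: ltnW.
split.
  rewrite (expected_visits_sum k02 hlambda hwalk); congr EFin.
  by apply: eq_bigr => i _; rewrite natrD.
(* With [K = k0 + i], [prob_v1S] reads [Q i.+1 = e * Q i + (1 - e) / K]; dividing by the product of
   the factors [e] makes the recursion telescope into the stated sum. *)
elim=> [|i IHi].
  by rewrite !big_geq// addr0 mulr1; exact: (prob_v1_0 k02 hlambda hwalk).
(* Index [i.+1] of the product belongs to the time interval from [i] to [i.+1], with [k0 + i]
   vertices. *)
have iE : k + i.+1%:R - 1 = (k0 + i)%:R by rewrite -natr1 natrD addrA addrK.
have iE2 : k + i.+1%:R - 2 = (k0 + i)%:R - 1 by rewrite -iE; lra.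
have K0 : (k0 + i)%:R != 0 :> R.
  by rewrite pnatr_eq0 -lt0n addn_gt0 (ltnW k02).
rewrite !(big_nat_recr i.+1)//=.
rewrite iE iE2.
move: IHi; set p := \prod_(1 <= l < i.+1) _; set s := \sum_(1 <= j < i.+1) _ => IHi.
have -> : Q i.+1 = _ := prob_v1S k02 hlambda hwalk i.
rewrite -[prob_v1 _ _ _]/(Q i) IHi.
have p0 : p != 0.
  by rewrite gt_eqF// prodr_gt0// => l _; exact: expR_gt0.
set e := expR _.
have e0 : e != 0 by rewrite gt_eqF// expR_gt0.
move: p0 K0 e0; generalize p e ((k0 + i)%:R : R); clearbody s => p' e' K p0 K0 e0.
by field; apply/and3P.
Qed.
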